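(* Let $\alpha\in(1,2)$ and let $\mu$ be an unbounded complex-valued function on $[0,1]^2$. For $M>0$ let $\mu_M(x,y)=\mu(x,y)$ if $|\mu(x,y)|\le M$ and $\mu_M(x,y)=M$ otherwise. Suppose that $\mu_M$ is Riemann-integrable for every $M>0$ and that $\{\mu_M\}_M$ converges pointwise to $\mu$ as $M\to\infty$. With $\hat B_{\mathbf n}=T_{\mathbf n}(t_\alpha)$, $\mathbf n=(n,n)$, $h=\frac1{n+1}$, the following hold: (b1) $\{\hat B_{\mathbf n}+h^\alpha D_{\mathbf n}(\mu)\}_n\sim_{\rm GLT} t_\alpha$; (b2) $\{\hat B_{\mathbf n}+h^\alpha D_{\mathbf n}(\mu)\}_n\sim_\sigma t_\alpha$.
   Context: **Matrices.** For $n\in\mathbb N$ put $\mathbf n=(n,n)$ and $h=h(n)=\frac{1}{n+1}$; all matrix sequences below are indexed by $n\to\infty$ and consist of matrices of size $d_n=n^2$. Rows and columns are indexed by pairs $\mathbf i=(i_1,i_2)$, $1\le i_1,i_2\le n$, in lexicographic order. For $f\in L^1([-\pi,\pi]^2)$, $T_{\mathbf n}(f)=[\hat f_{\mathbf i-\mathbf j}]_{\mathbf i,\mathbf j}$ with $\hat f_{\mathbf k}=\frac1{(2\pi)^2}\int_{[-\pi,\pi]^2}f(\theta_1,\theta_2)e^{-\mathrm i(k_1\theta_1+k_2\theta_2)}\,d\theta_1d\theta_2$. The function $t_\alpha$ is $t_\alpha(\theta_1,\theta_2)=\left[4\sin^2(\theta_1/2)+4\sin^2(\theta_2/2)\right]^{\alpha/2}$.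 $D_{\mathbf n}(\mu)$ is the $n^2\times n^2$ diagonal matrix with diagonal entries $\mu(ih,jh)$, $1\le i,j\le n$, in lexicographic order. $\|\cdot\|$ is the spectral norm. **Distributions.** Let $\psi:D\subset\mathbb R^t\to\mathbb C$ be measurable with $0<|D|<\infty$. $\{A_n\}_n\sim_\sigma\psi$ means $\lim_{n\to\infty}\frac1{d_n}\sum_{i=1}^{d_n}F(\sigma_i(A_n))=\frac1{|D|}\int_D F(|\psi(x)|)\,dx$ for every continuous compactly supported $F:\mathbb R\to\mathbb C$, where $\sigma_i$ denotes singular values. For $t_\alpha$ take $D=[-\pi,\pi]^2$. **GLT sequences (2-level, scalar).** A class $\{\{B_{n,m}\}_n\}_m$ is an approximating class of sequences (a.c.s.) for $\{A_n\}_n$ if for every $m$ there is $n_m$ such that for all $n\ge n_m$ one has $A_n=B_{n,m}+R_{n,m}+N_{n,m}$ with $\mathrm{rank}\,R_{n,m}\le c(m)d_n$ and $\|N_{n,m}\|\le\omega(m)$, where $n_m$, $c(m)$, $\omega(m)$ depend only on $m$ and $c(m),\omega(m)\to0$ as $m\to\infty$. For a measurable $\kappa:[0,1]^2\times[-\pi,\pi]^2\to\mathbb C$, $\{A_n\}_n\sim_{\rm GLT}\kappa$ (generalized locally Toeplitz sequence with symbol $\kappa$) means: for each $m\in\mathbb N$ there are finitely many functions $a_{i,m}\in C^\infty([0,1]^2)$ and trigonometric polynomials $f_{i,m}$ in two variables, $i=1,\dots,N_m$, such that $\sum_i a_{i,m}(\mathbf x)f_{i,m}(\boldsymbol\theta)\to\kappa(\mathbf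 x,\boldsymbol\theta)$ in measure as $m\to\infty$ and $\{\{\sum_{i}\mathrm{diag}_{\mathbf j}\big(a_{i,m}(\mathbf j/n)\big)\,T_{\mathbf n}(f_{i,m})\}_n\}_m$ is an a.c.s. for $\{A_n\}_n$. A function of $\boldsymbol\theta$ only, such as $t_\alpha$, is regarded as a function of $(\mathbf x,\boldsymbol\theta)$. *)

(* Defs.v *)
From HB Require Import structures.
From mathcomp Require Import all_boot all_order all_algebra.
From mathcomp Require Import complex.
From mathcomp Require Import all_classical all_reals all_analysis.

Set Implicit Arguments.
Unset Strict Implicit.
Unset Printing Implicit Defensive.

Import Order.TTheory GRing.Theory Num.Theory.
Import numFieldNormedType.Exports.

Local Open Scope classical_set_scope.
Local Open Scope ring_scope.
Local Open Scope complex_scope.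
Local Open Scope sesquilinear_scope.

Notation normc := ComplexField.Normc.normc.

Section ComplexAnalysis.
Context {R : realType}.

Definition expi (t : R) : R[i] := cos t +i* sin t.

(* Borel measurability. Every Lebesgue measurable function is a.e. equal to a
   Borel one, and the notions below only depend on a.e. classes. *)
Definition cmeasurable_fun d (T : measurableType d) (D : set T)
    (f : T -> R[i]) : Prop :=
  measurable_fun D (fun x => complex.Re (f x)) /\
  measurable_fun D (fun x => complex.Im (f x)).

Definition cintegral d (T : measurableType d) (mu : {measure set T -> \bar R})
    (D : set T) (f : T -> R[i]) : R[i] :=
  Rintegral mu D (fun x => complex.Re (f x)) +i*
  Rintegral mu D (fun x => complex.Im (f x)).

Definition leb2 : set (measurableTypeR R * measurableTypeR R) -> \bar R :=
  (@lebesgue_measure R \x @lebesgue_measure R)%E.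

HB.instance Definition _ := Measure.on leb2.

Let leb2_sigma_finite : sigma_finite setT leb2.
Proof.
have /sigma_finiteP[F [TF ndF Foo]] := sigma_finiteT (@lebesgue_measure R).
exists (fun n => F n `*` F n).
  rewrite -setXTT TF predeqE => -[x y]; split.
    move=> [/= [n _ Fnx] [k _ Fky]]; exists (maxn n k) => //; split.
    - by move: x Fnx; exact/subsetPset/ndF/leq_maxl.
    - by move: y Fky; exact/subsetPset/ndF/leq_maxr.
  by move=> [n _ []/= ? ?]; split; exists n.
move=> k; have [? ?] := Foo k; split; first exact: measurableX.
by rewrite /leb2 product_measure1E// lte_mul_pinfty// ge0_fin_numE.
Qed.

(* This instance is not inferable for a general product: the canonical one in
   the library is keyed on pairs of probability measures. *)
HB.instance Definition _ :=
  Measure_isSigmaFinite.Build _ _ _ leb2 leb2_sigma_finite.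

Definition leb4 :
    set ((measurableTypeR R * measurableTypeR R) *
         (measurableTypeR R * measurableTypeR R)) -> \bar R :=
  (leb2 \x leb2)%E.

HB.instance Definition _ := Measure.on leb4.

Definition square : set (R * R) := `[0, 1] `*` `[0, 1].
Definition torus : set (R * R) := `[- pi, pi] `*` `[- pi, pi].

(* All iterated partial derivatives of order at most [k] exist and are
   continuous on the whole plane. *)
Fixpoint Ck (k : nat) (f : R * R -> R) : Prop :=
  continuous f /\
  if k is k'.+1 then
    [/\ forall x, derivable f x (1, 0), forall x, derivable f x (0, 1),
        Ck k' (fun x => 'D_(1, 0) f x) & Ck k' (fun x => 'D_(0, 1) f x)]
  else True.

(* C^oo on the closed square: the restriction of a C^oo function on R^2. The
   values of [a] outside the square are irrelevant. *)
Definition smooth_on_square (a : R * R -> R[i]) : Prop :=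
  exists g h : R * R -> R,
    (forall k, Ck k g /\ Ck k h) /\ {in square, forall x, a x = g x +i* h x}.

Definition trig_poly (f : R * R -> R[i]) : Prop :=
  exists (s : seq (int * int)) (c : int * int -> R[i]),
    forall t, f t = \sum_(k <- s) c k * expi (k.1%:~R * t.1 + k.2%:~R * t.2).

(* As in [itv_partition], the partition points are [0 :: p]: the [i]-th cell is
   [nth 1 (0 :: p) i, nth 1 p i]. The Riemann integral over the square is the
   limit of the tagged Riemann sums over grids as the mesh tends to 0; for a
   complex function this amounts to integrability of both components. *)
Definition riemann_sum2 (f : R * R -> R[i]) (p q : seq R)
    (xi : nat -> nat -> R * R) : R[i] :=
  \sum_(i < size p) \sum_(j < size q)
    ((nth 1 p i - nth 1 (0 :: p) i) * (nth 1 q j - nth 1 (0 :: q) j))%:C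
    * f (xi i j).

Definition mesh_lt (p : seq R) (delta : R) : Prop :=
  forall i, (i < size p)%N -> nth 1 p i - nth 1 (0 :: p) i < delta.

Definition tagged (p q : seq R) (xi : nat -> nat -> R * R) : Prop :=
  forall i j, (i < size p)%N -> (j < size q)%N ->
    nth 1 (0 :: p) i <= (xi i j).1 <= nth 1 p i /\
    nth 1 (0 :: q) j <= (xi i j).2 <= nth 1 q j.

Definition riemann_integrable_square (f : R * R -> R[i]) : Prop :=
  exists I : R[i], forall eps : R, 0 < eps ->
    exists2 delta : R, 0 < delta &
    forall p q xi, itv_partition 0 1 p -> itv_partition 0 1 q ->
      mesh_lt p delta -> mesh_lt q delta -> tagged p q xi ->
      normc (riemann_sum2 f p q xi - I) < eps.

Definition trunc_fun (M : R) (mu : R * R -> R[i]) : R * R -> R[i] :=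
  fun x => if normc (mu x) <= M then mu x else M%:C.

End ComplexAnalysis.

Section Matrices.
Context {R : realType}.

(* Lexicographic order: position [k] (counted from 0) stands for the pair
   (k / n + 1, k mod n + 1), with 1-based components. *)
Definition idx1 n (k : 'I_(n * n)) : nat := (k %/ n).+1.
Definition idx2 n (k : 'I_(n * n)) : nat := (k %% n).+1.

Definition fourier_coef (f : R * R -> R[i]) (k1 k2 : int) : R[i] :=
  ((2 * pi) ^- 2)%:C *
  cintegral leb2 torus
    (fun t => f t * expi (- (k1%:~R * t.1 + k2%:~R * t.2))).

Definition toeplitz n (f : R * R -> R[i]) : 'M[R[i]]_(n * n) :=
  \matrix_(r, s) fourier_coef f ((idx1 r)%:Z - (idx1 s)%:Z)
                                ((idx2 r)%:Z - (idx2 s)%:Z).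

Definition hstep (n : nat) : R := (n.+1%:R)^-1.

(* [diag_h] samples on the grid (i h, j h) with h = 1 / (n + 1), [diag_n] on the
   grid (i / n, j / n). *)
Definition diag_h n (mu : R * R -> R[i]) : 'M[R[i]]_(n * n) :=
  diag_mx (\row_k mu ((idx1 k)%:R * hstep n, (idx2 k)%:R * hstep n)).

Definition diag_n n (a : R * R -> R[i]) : 'M[R[i]]_(n * n) :=
  diag_mx (\row_k a ((idx1 k)%:R / n%:R, (idx2 k)%:R / n%:R)).

Definition t_ (alpha : R) (t : R * R) : R[i] :=
  ((4 * sin (t.1 / 2) ^+ 2 + 4 * sin (t.2 / 2) ^+ 2) `^ (alpha / 2))%:C.

(* Square roots of the eigenvalues of A^* A, with multiplicity and in no
   particular order. *)
Definition sing_val d (A : 'M[R[i]]_d) (i : 'I_d) : R :=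
  Num.sqrt (complex.Re (spectral_diag (A^t* *m A) 0 i)).

Definition spectral_norm d (A : 'M[R[i]]_d) : R :=
  \big[Num.max/0]_(i < d) sing_val A i.

End Matrices.

Section Sequences.
Context {R : realType}.

Definition mxseq := forall n : nat, 'M[R[i]]_(n * n).

(* Distribution of singular values, for a symbol on a domain of an arbitrary
   measure space; [psi] is only considered on [D]. *)
Definition sigma_distributed d (T : measurableType d)
    (mu : {measure set T -> \bar R}) (A : mxseq) (D : set T)
    (psi : T -> R[i]) : Prop :=
  [/\ measurable D, (0 < mu D < +oo)%E, cmeasurable_fun D psi &
    forall F : R -> R[i]^o, continuous F ->
      compact (closure [set y | F y != 0]) ->
      ((n * n)%:R^-1 * \sum_(i < n * n) F (sing_val (A n) i) : R[i]^o)
        @[n --> \oo]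
        --> (((fine (mu D))^-1)%:C *
               cintegral mu D (fun x => F (normc (psi x))) : R[i]^o)].

(* [B m n] is the matrix B_{n,m}. *)
Definition acs (B : nat -> mxseq) (A : mxseq) : Prop :=
  exists c omega : nat -> R,
    [/\ c @ \oo --> 0, omega @ \oo --> 0 &
      forall m, exists nm, forall n, (nm <= n)%N ->
        exists Rnm Nnm : 'M[R[i]]_(n * n),
          [/\ A n = B m n + Rnm + Nnm,
              (\rank Rnm)%:R <= c m * (n * n)%:R &
              spectral_norm Nnm <= omega m]].

Definition cvg_in_measure d (T : measurableType d)
    (mu : {measure set T -> \bar R}) (D : set T) (f : nat -> T -> R[i])
    (g : T -> R[i]) : Prop :=
  forall eps : R, 0 < eps ->
    mu (D `&` [set x | eps < normc (f m x - g x)]) @[m --> \oo] --> 0%E.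

Definition GLT (A : mxseq) (kappa : (R * R) * (R * R) -> R[i]) : Prop :=
  cmeasurable_fun (square `*` torus) kappa /\
  exists (N : nat -> nat) (a f : nat -> nat -> R * R -> R[i]),
    [/\ forall m i, (i < N m)%N ->
          smooth_on_square (a m i) /\ trig_poly (f m i),
        cvg_in_measure leb4 (square `*` torus)
          (fun m z => \sum_(i < N m) a m i z.1 * f m i z.2) kappa &
        acs (fun m n => \sum_(i < N m) diag_n n (a m i) *m toeplitz n (f m i))
            A].

End Sequences.

(* Main.v *)
Require Import Defs.
From HB Require Import structures.
From mathcomp Require Import all_boot all_order all_algebra.
From mathcomp Require Import complex ring lra zify.
From mathcomp Require Import all_classical all_reals all_analysis.
From mathcomp Require Import measurable_realfun.

Set Implicit Arguments.
Unset Strict Implicit.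
Unset Printing Implicit Defensive.

Import Order.TTheory GRing.Theory Num.Theory.
Import numFieldNormedType.Exports.

(** Why the theorem holds. Write tau(theta) = 4 sin^2(theta_1 / 2) +
    4 sin^2(theta_2 / 2), so that t_alpha = tau^(alpha / 2) is a continuous
    function of a real trigonometric polynomial with values in [0, 8]. If the
    polynomial p is eps-close to x^(alpha / 2) on [0, 8], then p(tau) is a
    trigonometric polynomial and
<<
      A_n = T_n(p(tau)) + T_n(t_alpha - p(tau)) + h^alpha D_n(mu).
>>
    The second term has norm at most eps ([toeplitz_norm]). The third one is
    split by the size of the samples of mu. Those of modulus at most K
    contribute a matrix of norm at most h^alpha K, which tends to 0; the others
    contribute a matrix whose rank is the number of samples exceeding K. That
    number is at most eps n^2 as soon as K and n are large enough
    ([few_large_values]), and this is the only place where mu matters.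

    [few_large_values] is where integrability enters. If it failed, then for
    every K there would be arbitrarily fine grids with more than eps n^2
    samples of modulus above K. As the truncation of mu at level K is Riemann
    integrable, it oscillates little on most cells of a fine enough grid, so on
    a union of cells of measure at least eps / 8 one has |mu| >= K / 2. The
    upper limit of these sets as K tends to infinity has measure at least
    eps / 8, yet it is empty because mu takes finite values.

    The decomposition ([fde_decomposition]) gives the GLT property at once, with
    the trigonometric polynomials p(tau) and constant coefficients.

    For the singular values, T_n(p(tau)) differs only in its boundary rows from
    the circulant matrix that the discrete Fourier transform diagonalizes with
    eigenvalues p(tau(theta_k)), theta_k on the grid of frequencies
    ([toeplitz_circulant_rank]); hence A_n is this circulant matrix plus a
    matrix of small relative rank plus a matrix of small norm. A dimension count
    ([weyl_counting]) compares the numbers of singular values above a threshold,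
    and a staircase approximation of F turns this into closeness of the means of
    F over the two families of singular values ([count_close]). The mean of
    F(|p(tau(theta_k))|) is close to that of q(tau(theta_k)), where q is a
    polynomial close to F(x^(alpha / 2)) on [0, 8], and for the trigonometric
    polynomial q(tau) the grid mean equals the mean over the torus exactly
    ([grid_mean_fourier_sum]). *)

Local Open Scope ring_scope.
Local Open Scope complex_scope.
Local Open Scope sesquilinear_scope.

(** * Singular values under perturbations of small rank or small norm *)

Section SingularValues.
Context {R : realType}.
Local Notation C := R[i].

Definition vnorm d (v : 'rV[C]_d) : C := sqrtC (dotmx v v).

Lemma vnorm_ge0 d (v : 'rV[C]_d) : 0 <= vnorm v.
Proof. by rewrite sqrtC_ge0 dnorm_ge0. Qed.

Lemma vnormD d (u v : 'rV[C]_d) : vnorm (u + v) <= vnorm u + vnorm v.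
Proof. by have [] := triangle_lerif (@dotmx C d) u v. Qed.

Lemma dotmx_sum d (v : 'rV[C]_d) : dotmx v v = \sum_i `|v 0 i| ^+ 2.
Proof.
rewrite dotmxE !mxE; apply: eq_bigr => i _.
by rewrite !mxE normCK.
Qed.

(** Working with any unitary diagonalization of A^* A, instead of the one
    chosen by [sing_val], lets the comparison below treat alike the singular
    values of an arbitrary matrix and those known explicitly for a circulant. *)
Definition has_singular_values d (A : 'M[C]_d) (a : 'I_d -> R) : Prop :=
  (forall i, 0 <= a i) /\
  exists2 P : 'M[C]_d, P \is unitarymx &
    A^t* *m A = P^t* *m diag_mx (\row_i (a i ^+ 2)%:C) *m P.

Lemma sing_val_ge0 d (A : 'M[C]_d) i : 0 <= sing_val A i.
Proof. exact: sqrtr_ge0. Qed.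

Lemma sing_val_has_singular_values d (A : 'M[C]_d) :
  has_singular_values A (sing_val A).
Proof.
split; first exact: sing_val_ge0.
set G := A^t* *m A.
have Gn : G \is normalmx.
  by apply/normalmxP; rewrite /G !trmx_mul !map_mxM /= !trmxCK.
have := orthomx_spectralP Gn; set P := spectralmx G;
  set D := spectral_diag G => GE.
have Pu : P \is unitarymx by exact: spectral_unitarymx.
exists P => //; rewrite {}[LHS]GE invmx_unitary//; congr (_ *m diag_mx _ *m _).
apply/rowP => i; rewrite !mxE /sing_val -/G -/D.
have D0 : 0 <= D 0 i.
  have E : P *m G *m P^t* = diag_mx D.
    rewrite (orthomx_spectralP Gn) -/P -/D invmx_unitary//.
    by rewrite !mulmxA (unitarymxP Pu) mul1mx -mulmxA (unitarymxP Pu) mulmx1.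
  have -> : D 0 i = (P *m G *m P^t*) i i by rewrite E !mxE eqxx mulr1n.
  have -> : P *m G *m P^t* = (P *m A^t*) *m (P *m A^t*)^t*.
    by rewrite trmx_mul map_mxM /= trmxCK /G !mulmxA.
  rewrite mxE; apply: sumr_ge0 => j _; rewrite !mxE; exact: mul_conjC_ge0.
rewrite sqr_sqrtr; last by move: D0; rewrite lecE => /andP[].
by rewrite RRe_real// ger0_real.
Qed.

Section span.
Variables (d : nat) (A : 'M[C]_d) (a : 'I_d -> R) (P : 'M[C]_d).
Hypothesis Pu : P \is unitarymx.
Hypothesis AE : A^t* *m A = P^t* *m diag_mx (\row_i (a i ^+ 2)%:C) *m P.
Variable S : {set 'I_d}.

Definition span_rows : 'M[C]_(#|S|, d) := rowsub (@enum_val _ (mem S)) P.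

Lemma span_rows_unitary : span_rows \is unitarymx.
Proof.
apply/row_unitarymxP => i j; rewrite /span_rows !row_rowsub.
move/row_unitarymxP: Pu => ->.
by rewrite (inj_eq enum_val_inj).
Qed.

Lemma rank_span_rows : \rank span_rows = #|S|.
Proof. exact: mxrank_unitary span_rows_unitary. Qed.

Lemma dot_span_rows (y : 'rV[C]_#|S|) :
  dotmx (y *m span_rows) (y *m span_rows) = \sum_i `|y 0 i| ^+ 2.
Proof.
rewrite dotmxE trmx_mul map_mxM /= mulmxA -(mulmxA y).
by rewrite (unitarymxP span_rows_unitary) mulmx1 -dotmxE dotmx_sum.
Qed.

Lemma dot_span_rows_mul (y : 'rV[C]_#|S|) :
  dotmx (y *m span_rows *m A^t*) (y *m span_rows *m A^t*) =
  \sum_i (a (enum_val i) ^+ 2)%:C * `|y 0 i| ^+ 2.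
Proof.
have GE : span_rows *m (A^t* *m A) =
   diag_mx (\row_i (a (enum_val i) ^+ 2)%:C) *m span_rows.
  rewrite AE /span_rows mul_rowsub_mx !mulmxA (unitarymxP Pu) mul1mx.
  by rewrite !mul_diag_mx; apply/matrixP => i j; rewrite !mxE.
rewrite dotmxE trmx_mul map_mxM /= trmxCK mulmxA -(mulmxA _ (A^t*)) -(mulmxA y).
rewrite GE trmx_mul map_mxM /= !mulmxA -(mulmxA _ span_rows).
rewrite (unitarymxP span_rows_unitary) mulmx1 mxE.
apply: eq_bigr => i _; rewrite !mxE (bigD1 i) //= big1 ?addr0.
  by rewrite !mxE eqxx mulr1n mulrAC [RHS]mulrC normCK.
by move=> k ki; rewrite !mxE (negbTE ki) mulr0n mulr0.
Qed.

End span.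

(** The rows of P with small singular value span the space. A^* acts on row
    vectors from the right, because the square of |v A^*| is v (A^* A) v^*. *)
Lemma small_singular_space d (A : 'M[C]_d) (a : 'I_d -> R) (t : R) :
  has_singular_values A a ->
  exists2 V : 'M[C]_(#|[set i | a i <= t]|, d),
    \rank V = #|[set i | a i <= t]| &
    0 <= t -> forall v : 'rV[C]_d, (v <= V)%MS ->
      vnorm (v *m A^t*) <= t%:C * vnorm v.
Proof.
move=> [a0 [P Pu AE]]; exists (span_rows P [set i | a i <= t]).
  exact: rank_span_rows.
move=> t0 v /submxP[y ->].
rewrite /vnorm (dot_span_rows_mul Pu AE) (dot_span_rows Pu).
have -> : t%:C = sqrtC (t%:C ^+ 2) by rewrite sqrCK// ler0c.
rewrite -sqrtCM ?nnegrE ?exprn_ge0 ?ler0c ?sumr_ge0//.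
rewrite ler_sqrtC ?nnegrE ?mulr_ge0 ?exprn_ge0 ?ler0c ?sumr_ge0//; last first.
- by move=> i _; rewrite mulr_ge0// ?exprn_ge0// lecR sqr_ge0.
rewrite mulr_sumr ler_sum // => i _; rewrite ler_wpM2r ?exprn_ge0//.
have := enum_valP i; rewrite inE => h.
by rewrite -rmorphXn lecR /= ler_pXn2r// nnegrE.
Qed.

Lemma large_singular_space d (A : 'M[C]_d) (a : 'I_d -> R) (t : R) :
  has_singular_values A a ->
  exists2 V : 'M[C]_(#|[set i | t < a i]|, d),
    \rank V = #|[set i | t < a i]| &
    0 <= t -> forall v : 'rV[C]_d, (v <= V)%MS -> v != 0 ->
      t%:C * vnorm v < vnorm (v *m A^t*).
Proof.
move=> [a0 [P Pu AE]]; exists (span_rows P [set i | t < a i]).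
  exact: rank_span_rows.
move=> t0 v /submxP[y ->] v0.
rewrite /vnorm (dot_span_rows_mul Pu AE) (dot_span_rows Pu).
have -> : t%:C = sqrtC (t%:C ^+ 2) by rewrite sqrCK// ler0c.
rewrite -sqrtCM ?nnegrE ?exprn_ge0 ?ler0c ?sumr_ge0//.
rewrite ltr_sqrtC ?nnegrE ?mulr_ge0 ?exprn_ge0 ?ler0c ?sumr_ge0//; last first.
- by move=> i _; rewrite mulr_ge0// ?exprn_ge0// lecR sqr_ge0.
have [i yi] : exists i, y 0 i != 0.
  apply/existsP; apply: contraR v0; rewrite negb_exists => /forallP h.
  suff -> : y = 0 by rewrite mul0mx.
  by apply/rowP => i; rewrite mxE; apply/eqP; rewrite -[_ == _]negbK h.
have h (j : 'I_#|[set i | t < a i]|) : t < a (enum_val j)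
  by have := enum_valP j; rewrite inE.
rewrite mulr_sumr (bigD1 i) //= [ltRHS](bigD1 i) //=.
apply: ltr_leD.
  rewrite ltr_pM2r ?exprn_gt0 ?normr_gt0//.
  by rewrite -rmorphXn ltcR /= ltr_pXn2r// nnegrE.
apply: ler_sum => j _; rewrite ler_wpM2r ?exprn_ge0//.
by rewrite -rmorphXn lecR /= ler_pXn2r// ?nnegrE // ltW.
Qed.

(** Weyl's inequality for singular values, in counting form. If it failed, the
    space where B^* stretches by more than t + w, the one where A^* stretches by
    at most t and the kernel of Rm^* would have dimensions adding up to more
    than 2 d, hence a common nonzero vector; there B^* = A^* + N^* stretches by
    at most t + w. *)
Lemma weyl_counting d (A B Rm N : 'M[C]_d) (a b : 'I_d -> R) (t w : R) :
  has_singular_values A a -> has_singular_values B b ->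
  B = A + Rm + N -> 0 <= w ->
  (forall v : 'rV[C]_d, vnorm (v *m N^t*) <= w%:C * vnorm v) ->
  (#|[set i | (t + w < b i)%R]| <= #|[set i | (t < a i)%R]| + \rank Rm)%N.
Proof.
move=> Aa Bb BE w0 Nw.
have [t0|t0] := ltP t 0.
  have -> : [set i | t < a i] = finset.setT.
    by apply/setP => i; rewrite !inE; apply: lt_le_trans t0 _; case: Aa.
  by rewrite cardsT (leq_trans (max_card _)) // leq_addr.
have [U rU Uh] := small_singular_space t Aa.
have [V rV Vh] := large_singular_space (t + w) Bb.
rewrite leqNgt; apply/negP => lt.
have cU : (#|[set i | (a i <= t)%R]| + #|[set i | (t < a i)%R]| = d)%N.
  rewrite -[RHS]card_ord -cardsT -(cardsID [set i | a i <= t] finset.setT).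
  by congr addn; apply: eq_card => i; rewrite !inE // -?ltNge ?andbT.
pose K := kermx (Rm^t*).
have rK : \rank K = (d - \rank Rm)%N by rewrite mxrank_ker mxrank_map mxrank_tr.
have r1 := mxrank_sum_cap U K.
have r2 := mxrank_sum_cap (U :&: K)%MS V.
have s1 := rank_leq_col (U + K)%MS.
have s2 := rank_leq_col (U :&: K + V)%MS.
have s3 := rank_leq_row Rm.
have : (0 < \rank (U :&: K :&: V))%N.
  rewrite rK rU in r1; rewrite rV in r2.
  move: r1 r2 s1 s2 s3 lt cU.
  set x1 := \rank _; set x2 := \rank _; set x3 := \rank _; set x4 := \rank _;
    set x5 := \rank _.
  set y1 := #|_|; set y2 := #|_|; set y3 := #|_|.
  move=> *; lia.
rewrite lt0n mxrank_eq0 => /rowV0Pn[v vX v0].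
move: vX; rewrite !sub_capmx => /andP[/andP[vU /sub_kermxP vK] vV].
have := Vh (addr_ge0 t0 w0) _ vV v0.
have -> : B^t* = A^t* + Rm^t* + N^t* by rewrite BE !linearD /= !map_mxD.
rewrite !mulmxDr vK addr0.
move=> /lt_le_trans /(_ (vnormD _ _)).
move=> /lt_le_trans /(_ (lerD (Uh t0 _ vU) (Nw v))).
by rewrite rmorphD /= mulrDl ltxx.
Qed.

(** A singular value above w comes with a vector that N^* stretches by more
    than w. *)
Lemma spectral_norm_le d (N : 'M[C]_d) (w : R) : 0 <= w ->
  (forall v : 'rV[C]_d, vnorm (v *m N^t*) <= w%:C * vnorm v) ->
  spectral_norm N <= w.
Proof.
move=> w0 Nw; rewrite /spectral_norm.
elim/big_ind : _ => [//|x y xw yw|i _]; first by rewrite ge_max xw.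
rewrite leNgt; apply/negP => wi.
have [V rV Vh] := large_singular_space w (sing_val_has_singular_values N).
have : (0 < \rank V)%N by rewrite rV; apply/card_gt0P; exists i; rewrite inE.
rewrite lt0n mxrank_eq0 => /rowV0Pn[v vV v0].
by have := lt_le_trans (Vh w0 _ vV v0) (Nw v); rewrite ltxx.
Qed.

(** M is the sum, over i in S, of its compositions with the coordinate
    projections, which have rank at most one. *)
Lemma rank_few_rows d (M : 'M[C]_d) (S : {set 'I_d}) :
  (forall i j, i \notin S -> M i j = 0) -> (\rank M <= #|S|)%N.
Proof.
move=> h.
have -> : M = \sum_(i in S) delta_mx i i *m M.
  apply/matrixP => i j; rewrite summxE.
  have E k : (delta_mx k k *m M) i j = (k == i)%:R * M i j.
    rewrite mxE (bigD1 k) //= big1 ?addr0.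
      rewrite !mxE eqxx andbT eq_sym.
      by have [->|] := eqVneq i k; rewrite ?eqxx ?mul0r//.
    by move=> l lk; rewrite !mxE (negbTE lk) andbF mul0r.
  have [iS|iS] := boolP (i \in S); last first.
    by rewrite h // big1 // => k _; rewrite E h // mulr0.
  rewrite (bigD1 i) //= E eqxx mul1r big1 ?addr0// => k /andP[_ ki].
  by rewrite E (negbTE ki) mul0r.
rewrite -sum1_card.
elim/big_ind2 : _ => [|n1 M1 n2 M2 h1 h2|i _]; first by rewrite mxrank0.
  exact: leq_trans (mxrank_add _ _) (leq_add h1 h2).
by rewrite (leq_trans (mxrankM_maxl _ _)) // mxrank_delta.
Qed.

End SingularValues.

Local Open Scope classical_set_scope.

(** * Polynomial approximation and comparison of counting functions *)

Section Approximation.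
Context {R : realType}.

(** Only x is confined to the segment: the covering argument controls f on a
    whole neighbourhood of each of its points. *)
Lemma uniform_continuity_segment (f : R -> R) (a b eps : R) :
  continuous f -> 0 < eps ->
  exists2 delta : R, 0 < delta & forall x y : R, a <= x <= b ->
    `|x - y| < delta -> `|f x - f y| < eps.
Proof.
move=> cf e0.
have /compact_near_coveringP/near_covering_withinP := @segment_compact R a b.
move=> /(_ R (0 : R)^'+
  (fun d x => forall y, `|x - y| < d -> `|f x - f y| < eps) _) h.
have [|d /= d0 hd] := h.
  move=> x _.
  have /cvgrPdist_lt /(_ (eps / 2) (divr_gt0 e0 (ltr0n _ 2))) := cf x.
  move=> /nbhs_ballP[r /= r0 hr].
  exists (ball x (r / 2), [set d | 0 < d < r / 2]).
    split => /=; first by apply: nbhsx_ballx; rewrite divr_gt0.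
    near=> d; rewrite /=; apply/andP; split; near: d.
      exact: nbhs_right_gt.
    by apply: nbhs_right_lt; rewrite divr_gt0.
  move=> [x' d] /= [x'x /andP[d0 dr]] _ y yd.
  move: x'x; rewrite /ball /= => x'x.
  have h1 : `|f x - f x'| < eps / 2.
    by apply: hr; rewrite /ball /=; apply: lt_le_trans x'x _; lra.
  have h2 : `|f x - f y| < eps / 2.
    apply: hr; rewrite /ball /=.
    have -> : x - y = (x - x') + (x' - y) by ring.
    by apply: le_lt_trans (ler_normD _ _) _; lra.
  have -> : f x' - f y = - (f x - f x') + (f x - f y) by ring.
  by apply: le_lt_trans (ler_normD _ _) _; rewrite normrN; lra.
exists (d / 2); first by rewrite divr_gt0.
move=> x y xab; apply: (hd (d / 2) _ _ x) => /=.
- by rewrite sub0r normrN gtr0_norm ?divr_gt0//; lra.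
- by rewrite divr_gt0.
- by rewrite in_itv.
Unshelve. all: by end_near. Qed.

(** The Bernstein polynomial of the values f 0, ..., f n, by the recursion of
    de Casteljau. It makes monotonicity and the moments below immediate
    inductions, without binomial coefficients. *)
Fixpoint bernstein (n : nat) (f : nat -> R) : {poly R} :=
  if n is m.+1 then
    'X * bernstein m (fun k => f k.+1) + (1 - 'X) * bernstein m f
  else (f 0%N)%:P.

Lemma bernstein_le n f g (x : R) : 0 <= x <= 1 ->
  (forall k, (k <= n)%N -> f k <= g k) ->
  (bernstein n f).[x] <= (bernstein n g).[x].
Proof.
move=> /andP[x0 x1]; elim: n f g => [|n IH] f g fg /=.
  by rewrite !hornerC fg.
rewrite !hornerE lerD// ler_wpM2l ?subr_ge0 ?IH// => k kn; apply: fg => //.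
exact: leqW.
Qed.

(** For s = n x this is the variance of a binomial variable, which drives the
    convergence of Bernstein polynomials. *)
Lemma bernstein_quadratic n (u c s x : R) :
  (bernstein n (fun k => u + c * (k%:R - s) ^+ 2)).[x] =
  u + c * (n%:R * x * (1 - x) + (n%:R * x - s) ^+ 2).
Proof.
elim: n s => [|n IH] s /=; first by rewrite hornerC; ring.
rewrite !hornerE IH.
have -> : (fun k => u + c * (k.+1%:R - s) ^+ 2) =
          (fun k => u + c * (k%:R - (s - 1)) ^+ 2).
  by apply/funext => k; rewrite -natr1; ring.
by rewrite IH -natr1; ring.
Qed.

(** By uniform continuity near x and boundedness far from x, f differs from
    f x by at most eps / 2 plus a quadratic in the distance to x; by
    monotonicity the Bernstein polynomials of these two quadratics bracket that
    of f. *)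
Lemma weierstrass01 (f : R -> R) (eps : R) : continuous f -> 0 < eps ->
  exists p : {poly R}, forall x, 0 <= x <= 1 -> `|f x - p.[x]| <= eps.
Proof.
move=> cf e0.
have e20 : 0 < eps / 2 by rewrite divr_gt0.
have [d d0 hd] := uniform_continuity_segment 0 1 cf e20.
have cn : {within `[0, 1], continuous (fun x => `|f x|)}.
  apply: continuous_subspaceT => x.
  by apply: continuous_comp; [exact: cf|exact: norm_continuous].
have [x0 _ hM] := @EVT_max R (fun x => `|f x|) 0 1 ler01 cn.
set M : R := `|f x0| in hM.
have M0 : 0 <= M by exact: normr_ge0.
(* If x and y are at least d apart, then c (y - x)^2 >= 2 M >= |f x - f y|. *)
pose c : R := 2 * M / d ^+ 2.
have c0 : 0 <= c by rewrite divr_ge0 ?exprn_ge0 ?mulr_ge0// ltW.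
have key (x y : R) : 0 <= x <= 1 -> 0 <= y <= 1 ->
    `|f x - f y| <= eps / 2 + c * (y - x) ^+ 2.
  move=> x01 y01; have [xy|xy] := ltP `|x - y| d.
    by rewrite ler_wpDr ?(ltW (hd _ _ x01 xy))// mulr_ge0// sqr_ge0.
  apply: (@le_trans _ _ (2 * M)).
    apply: le_trans (ler_normB _ _) _.
    by rewrite mulr2n mulrDl mul1r lerD// hM// in_itv.
  rewrite ler_wpDl ?(ltW e20)//.
  have -> : c * (y - x) ^+ 2 = 2 * M * ((y - x) ^+ 2 / d ^+ 2).
    by rewrite /c; field; rewrite gt_eqF.
  rewrite ler_peMr ?mulr_ge0//.
  rewrite ler_pdivlMr ?exprn_gt0// mul1r -[leRHS]real_normK ?num_real//.
  by rewrite distrC ler_pXn2r// nnegrE ltW.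
have [n nE] : exists n : nat, c / (eps / 2) < n.+1%:R.
  exists (Num.truncn (c / (eps / 2))); exact: truncnS_gt.
exists (bernstein n.+1 (fun k => f (k%:R / n.+1%:R))) => x x01.
have N0 : 0 < n.+1%:R :> R by rewrite ltr0n.
set N : R := n.+1%:R in nE N0 *.
have k01 k : (k <= n.+1)%N -> 0 <= k%:R / N <= 1.
  by move=> kn; rewrite divr_ge0 ?(ltW N0)//= ler_pdivrMr// mul1r ler_nat.
have cN : c / N ^+ 2 * (N * x * (1 - x) + (N * x - N * x) ^+ 2) <= eps / 2.
  have -> : c / N ^+ 2 * (N * x * (1 - x) + (N * x - N * x) ^+ 2) =
            c / N * (x * (1 - x)) by field; rewrite gt_eqF.
  apply: (@le_trans _ _ (c / N)).
    by rewrite ler_piMr ?divr_ge0 ?(ltW N0)//; nra.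
  rewrite ler_pdivrMr// mulrC -ler_pdivrMr//; exact: ltW.
have E k : (k%:R / N - x) ^+ 2 = (k%:R - N * x) ^+ 2 / N ^+ 2.
  by field; rewrite gt_eqF.
rewrite ler_norml; apply/andP; split.
  rewrite lerBrDr addrC lerBlDr.
  apply: (@le_trans _ _ ((bernstein n.+1
    (fun k => (f x + eps / 2) + (c / N ^+ 2) * (k%:R - N * x) ^+ 2)).[x])).
    apply: bernstein_le => // k kn.
    have := key _ _ x01 (k01 _ kn); rewrite E ler_norml => /andP[h _].
    rewrite mulrAC -mulrA; move: h; set z := c * (_ / _); lra.
  by rewrite bernstein_quadratic -/N ?mulNr; move: cN; set z := c / N ^+ 2 * _;
    lra.
rewrite lerBlDr -lerBlDl.
apply: (@le_trans _ _ ((bernstein n.+1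
    (fun k => (f x - eps / 2) + (- (c / N ^+ 2)) * (k%:R - N * x) ^+ 2)).[x])).
  by rewrite bernstein_quadratic -/N ?mulNr; move: cN; set z := c / N ^+ 2 * _;
    lra.
apply: bernstein_le => // k kn.
have := key _ _ x01 (k01 _ kn); rewrite E ler_norml => /andP[_ h].
rewrite mulNr mulrAC -mulrA; move: h; set z := c * (_ / _); lra.
Qed.

Lemma weierstrass (f : R -> R) (b eps : R) : continuous f -> 0 < b -> 0 < eps ->
  exists p : {poly R}, forall x, 0 <= x <= b -> `|f x - p.[x]| <= eps.
Proof.
move=> cf b0 e0.
have cg : continuous (fun x => f (b * x)).
  by move=> x; apply: continuous_comp; [exact: mulrl_continuous|exact: cf].
have [p hp] := weierstrass01 cg e0.
exists (p \Po (b^-1 *: 'X)) => x /andP[x0 xb].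
rewrite horner_comp !hornerE.
have := hp (b^-1 * x); rewrite mulVKf ?gt_eqF//; apply.
by rewrite mulr_ge0 ?invr_ge0 ?(ltW b0)//= ler_pdivrMl// mulr1.
Qed.

Definition count_above d (a : 'I_d -> R) (t : R) : R := \sum_i (t < a i)%R%:R.

Lemma count_above_le d (a : 'I_d -> R) (t u : R) : t <= u ->
  count_above a u <= count_above a t.
Proof.
move=> tu; apply: ler_sum => i _; rewrite ler_nat.
by case: (ltP u (a i)) => // /(le_lt_trans tu) ->.
Qed.

Lemma count_above_ge0 d (a : 'I_d -> R) (t : R) : 0 <= count_above a t.
Proof. by apply: sumr_ge0 => i _; rewrite ler0n. Qed.

Lemma count_above_max d (a : 'I_d -> R) (t : R) : count_above a t <= d%:R.
Proof.
rewrite -[d in leRHS]card_ord -sum1_card natr_sum; apply: ler_sum => i _.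
by rewrite ler_nat leq_b1.
Qed.

(** A combination of threshold functions, hence its sum over a family depends
    only on the counting function of the family. *)
Definition staircase (G : R -> R) (delta : R) (K : nat) (x : R) : R :=
  G 0 + \sum_(j < K) (G (j.+1%:R * delta) - G (j%:R * delta)) *
                     (j%:R * delta < x)%R%:R.

(** Telescoping: the thresholds j delta below x form an initial segment. The
    right alternative is the region beyond the last step. *)
Lemma staircaseE G delta K x : 0 < delta -> 0 <= x ->
  exists2 m, (m <= K)%N & staircase G delta K x = G (m%:R * delta) /\
    (`|x - m%:R * delta| <= delta \/ m = K /\ K%:R * delta <= x).
Proof.
move=> d0 x0; rewrite /staircase; elim: K => [|K [m mK [E c]]].
  exists 0%N => //; rewrite big_ord0 addr0 mul0r; split=> //; right.
  by split.
have KS : K.+1%:R * delta = K%:R * delta + delta by rewrite -natr1; ring.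
rewrite big_ord_recr /= addrA E.
have [Kx|xK] := ltP (K%:R * delta) x.
  exists K.+1 => //; have Em : m = K.
    case: c => [|[]//]; rewrite ler_norml => /andP[_ xm].
    apply/eqP; rewrite eqn_leq mK /=; rewrite leqNgt; apply/negP => mK'.
    have : m.+1%:R * delta <= K%:R * delta by rewrite ler_pM2r// ler_nat.
    by rewrite -natr1 mulrDl mul1r; lra.
  rewrite Em mulr1; split; first by ring.
  have [h|h] := leP (K.+1%:R * delta) x; [by right|left].
  by rewrite ler_norml; apply/andP; split; lra.
rewrite mulr0 addr0; exists m; [exact: leqW|split => //; left].
case: c => // -[-> h].
by rewrite (@le_anti _ _ x (K%:R * delta)) ?subrr ?normr0 ?(ltW d0)// xK.
Qed.

Lemma telescope2 (u : nat -> R) K :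
  \sum_(j < K) (u j - u j.+2) = u 0%N + u 1%N - u K - u K.+1.
Proof.
elim: K => [|K IH]; first by rewrite big_ord0; ring.
by rewrite big_ord_recr /= IH; ring.
Qed.

(** Sum by parts. The means of G are replaced by those of its staircase, that
    is by a combination of counts at the thresholds j delta with small
    coefficients. The counts of a and b at j delta differ by at most r plus the
    number of a_i between (j - 1) delta and (j + 1) delta, and these numbers add
    up to at most twice the size of the family. *)
Lemma count_close (G : R -> R) (L eps : R) : continuous G ->
  (forall x, L <= x -> G x = 0) -> 0 < eps ->
  exists2 delta : R, 0 < delta & exists2 rho : R, 0 < rho &
    forall d (a b : 'I_d -> R) (w r : R),
      (forall i, 0 <= a i) -> (forall i, 0 <= b i) ->
      0 <= w <= delta -> r <= rho * d%:R ->
      (forall t, count_above b (t + w) <= count_above a t + r) ->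
      (forall t, count_above a (t + w) <= count_above b t + r) ->
      `|\sum_i G (a i) - \sum_i G (b i)| <= eps * d%:R.
Proof.
move=> cG GL eps0.
pose e := eps / 8; have e0 : 0 < e by rewrite divr_gt0.
have [d0 d00 hd0] := uniform_continuity_segment 0 (`|L|) cG e0.
have UC x y : 0 <= x -> 0 <= y -> `|x - y| < d0 -> `|G x - G y| <= e.
  move=> x0 y0 xy; have [xL|xL] := leP x `|L|.
    by apply/ltW/hd0; rewrite ?x0.
  have [yL|yL] := leP y `|L|.
    by rewrite distrC; apply/ltW/hd0; rewrite ?y0 // distrC.
  by rewrite !GL ?subrr ?normr0 ?(ltW e0)//;
    apply: le_trans (ler_norm L) (ltW _).
pose delta := d0 / 2; have delta0 : 0 < delta by rewrite divr_gt0.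
have deltalt : delta < d0 by rewrite /delta; lra.
exists delta => //.
(* The staircase has to reach the region where G vanishes. *)
pose K := (Num.truncn (`|L| / delta)).+1.
have KL : `|L| < K%:R * delta by rewrite -ltr_pdivrMr//; exact: truncnS_gt.
have K0 : 0 < K%:R :> R by rewrite ltr0n.
exists (K%:R^-1); first by rewrite invr_gt0.
move=> d a b w r a0 b0 /andP[w0 wd] rd ba ab.
have step x : 0 <= x -> `|G x - staircase G delta K x| <= e.
  move=> x0; have [m mK [-> [c|[-> c]]]] := staircaseE G K delta0 x0.
    by apply: UC => //; [rewrite mulr_ge0// ltW|apply: le_lt_trans c _].
  by rewrite !GL ?subrr ?normr0 ?(ltW e0)//; move: (ler_norm L); lra.
have sums (c : 'I_d -> R) : (forall i, 0 <= c i) ->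
    `|\sum_i G (c i) - \sum_i staircase G delta K (c i)| <= e * d%:R.
  move=> c0; rewrite -sumrB; apply: le_trans (ler_norm_sum _ _ _) _.
  apply: (@le_trans _ _ (\sum_(i < d) e)); first by apply: ler_sum => i _;
    exact: step.
  by rewrite sumr_const card_ord mulr_natr.
have stairsum (c : 'I_d -> R) : \sum_i staircase G delta K (c i) = d%:R * G 0 +
    \sum_(j < K) (G (j.+1%:R * delta) - G (j%:R * delta)) *
                 count_above c (j%:R * delta).
  rewrite /staircase big_split /= sumr_const card_ord mulr_natl; congr (_ + _).
  by rewrite exchange_big /=; apply: eq_bigr => j _; rewrite mulr_sumr.
pose u (j : nat) := count_above a ((j%:R - 1) * delta).
have r0 : 0 <= r.
  (* Beyond all the a_i, the hypothesis reads 0 <= count <= r. *)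
  have [t ht] : exists t, count_above a t = 0.
    exists (\sum_i a i); rewrite /count_above big1 // => i _.
    by rewrite ltNge (bigD1 i) //= ler_wpDr// sumr_ge0.
  by have := ba t; rewrite ht; have := count_above_ge0 b (t + w); lra.
have mid (j : nat) :
    `|count_above a (j%:R * delta) - count_above b (j%:R * delta)| <=
    r + (u j - u j.+2).
  have jm : (j%:R - 1) * delta + w <= j%:R * delta by lra.
  have jp : j%:R * delta + w <= (j.+2%:R - 1) * delta by rewrite -!natr1; lra.
  have h1 := le_trans (count_above_le b jm) (ba _).
  have h2 := le_trans (count_above_le a jp) (ab _).
  have jm' : (j%:R - 1) * delta <= j%:R * delta by lra.
  have jp' : j%:R * delta <= (j.+2%:R - 1) * delta by rewrite -!natr1; lra.
  have := count_above_le a jm'; have := count_above_le a jp'.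
  rewrite ler_norml /u; move: h1 h2; lra.
have stairs : `|\sum_i staircase G delta K (a i) -
    \sum_i staircase G delta K (b i)| <= e * (3 * d%:R).
  rewrite !stairsum opprD addrACA subrr add0r -sumrB.
  apply: le_trans (ler_norm_sum _ _ _) _.
  apply: (@le_trans _ _ (\sum_(j < K) e * (r + (u j - u j.+2)))).
    apply: ler_sum => j _; rewrite -mulrBr normrM ler_pM//.
    apply: UC; [by rewrite mulr_ge0// ltW|by rewrite mulr_ge0// ltW|].
    by rewrite -mulrBl -natr1 addrAC subrr add0r mul1r gtr0_norm.
  rewrite -mulr_sumr ler_pM2l// big_split /= telescope2 sumr_const card_ord.
  have Kr : r *+ K <= d%:R.
    by rewrite -[r *+ K]mulr_natl -ler_pdivlMl//.
  have := count_above_ge0 a ((K%:R - 1) * delta).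
  have := count_above_ge0 a ((K.+1%:R - 1) * delta).
  have := count_above_max a ((0 - 1) * delta).
  have := count_above_max a ((1 - 1) * delta).
  rewrite /u; lra.
have ha := sums a a0; have hb := sums b b0.
have -> : \sum_i G (a i) - \sum_i G (b i) =
  (\sum_i G (a i) - \sum_i staircase G delta K (a i)) +
  ((\sum_i staircase G delta K (a i) - \sum_i staircase G delta K (b i)) -
  (\sum_i G (b i) - \sum_i staircase G delta K (b i))) by ring.
apply: le_trans (ler_normD _ _) _.
apply: le_trans (lerD ha (ler_normB _ _)) _.
apply: le_trans (lerD (lexx _) (lerD stairs hb)) _.
have : 0 <= d%:R :> R by rewrite ler0n.
have -> : eps = 8 * e by rewrite /e; field.
nra.
Qed.

End Approximation.

(** * Grid samples of a function with Riemann integrable truncations *)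

Section GridSamples.
Context {R : realType}.
Local Notation C := R[i].

Lemma normc_ge0 (z : C) : 0 <= normc z.
Proof. by case: z => a b; exact: sqrtr_ge0. Qed.

Lemma normcB (x y : C) : normc (x - y) = normc (y - x).
Proof. by rewrite -opprB normcN. Qed.

Lemma cReB (x y : C) : complex.Re (x - y) = complex.Re x - complex.Re y.
Proof. by case: x; case: y. Qed.

Lemma cImB (x y : C) : complex.Im (x - y) = complex.Im x - complex.Im y.
Proof. by case: x; case: y. Qed.

Lemma normc_real (x : R) : normc x%:C = `|x|.
Proof. by rewrite /normc /= expr0n addr0 sqrtr_sqr. Qed.

Lemma normc_leReIm (z : C) : normc z <= `|complex.Re z| + `|complex.Im z|.
Proof.
case: z => a b /=; rewrite -[leRHS]ger0_norm ?addr_ge0// -sqrtr_sqr.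
rewrite ler_sqrt ?sqr_ge0// sqrrD !real_normK ?num_real//.
by rewrite addrAC lerDl mulrn_wge0 ?mulr_ge0.
Qed.

Lemma normc_ge_absRe (z : C) : `|complex.Re z| <= normc z.
Proof.
case: z => a b /=; rewrite -[leLHS]sqrtr_sqr ler_sqrt ?addr_ge0 ?sqr_ge0//.
by rewrite lerDl sqr_ge0.
Qed.

Lemma normc_ge_absIm (z : C) : `|complex.Im z| <= normc z.
Proof.
case: z => a b /=; rewrite -[leLHS]sqrtr_sqr ler_sqrt ?addr_ge0 ?sqr_ge0//.
by rewrite lerDr sqr_ge0.
Qed.

Lemma normc_lerB (x y : C) : normc x - normc y <= normc (x - y).
Proof. by rewrite lerBlDr; have := le_normcD (x - y) y; rewrite subrK. Qed.

Definition cell_area (p q : seq R) (i j : nat) : R :=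
  (nth 1 p i - nth 1 (0 :: p) i) * (nth 1 q j - nth 1 (0 :: q) j).

Lemma itv_partition_step (p : seq R) i : itv_partition 0 1 p ->
  (i < size p)%N -> 0 <= nth 1 p i - nth 1 (0 :: p) i.
Proof.
by move=> [/(pathP 1) h _] ip; rewrite subr_ge0 ltW// h.
Qed.

Lemma Re_riemann_sum2B (f : R * R -> C) p q xi xi' :
  complex.Re (riemann_sum2 f p q xi - riemann_sum2 f p q xi') =
  \sum_(i < size p) \sum_(j < size q) cell_area p q i j *
    (complex.Re (f (xi i j)) - complex.Re (f (xi' i j))).
Proof.
rewrite /riemann_sum2 -sumrB (raddf_sum (@complex.Re R : Rcomplex R -> R)).
apply: eq_bigr => i _;
  rewrite -sumrB (raddf_sum (@complex.Re R : Rcomplex R -> R)).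
apply: eq_bigr => j _; rewrite -mulrBr /cell_area.
by case: (f _) => a b; case: (f _) => c d /=; rewrite mul0r subr0.
Qed.

Lemma Im_riemann_sum2B (f : R * R -> C) p q xi xi' :
  complex.Im (riemann_sum2 f p q xi - riemann_sum2 f p q xi') =
  \sum_(i < size p) \sum_(j < size q) cell_area p q i j *
    (complex.Im (f (xi i j)) - complex.Im (f (xi' i j))).
Proof.
rewrite /riemann_sum2 -sumrB (raddf_sum (@complex.Im R : Rcomplex R -> R)).
apply: eq_bigr => i _;
  rewrite -sumrB (raddf_sum (@complex.Im R : Rcomplex R -> R)).
apply: eq_bigr => j _; rewrite -mulrBr /cell_area.
by case: (f _) => a b; case: (f _) => c d /=; rewrite mul0r addr0.
Qed.

(** Two tagged sums over the same fine partition differ by less than 2 e for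
    all choices of tags. Swapping the two tags in the cells where the difference
    is negative bounds the sum of the absolute differences, separately for the
    real and the imaginary part; hence the factor 4. *)
Lemma riemann_oscillation (f : R * R -> C) (e : R) :
  riemann_integrable_square f -> 0 < e ->
  exists2 delta : R, 0 < delta & forall p q xi xi',
    itv_partition 0 1 p -> itv_partition 0 1 q ->
    mesh_lt p delta -> mesh_lt q delta -> Defs.tagged p q xi ->
      Defs.tagged p q xi' ->
    \sum_(i < size p) \sum_(j < size q)
      cell_area p q i j * normc (f (xi i j) - f (xi' i j)) <= 4 * e.
Proof.
move=> [I hI] e0; have [delta d0 hd] := hI _ e0.
exists delta => // p q xi xi' pp pq mp mq tp tq.
(* Exchanging the tags cellwise makes all the terms nonnegative. *)
have osc (F : C -> R) (hF : forall z, `|F z| <= normc z)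
    (sF : forall xi xi', F (riemann_sum2 f p q xi - riemann_sum2 f p q xi') =
      \sum_(i < size p) \sum_(j < size q) cell_area p q i j *
      (F (f (xi i j)) - F (f (xi' i j)))) :
    \sum_(i < size p) \sum_(j < size q) cell_area p q i j *
      `|F (f (xi i j)) - F (f (xi' i j))| <= 2 * e.
  pose b i j := F (f (xi' i j)) <= F (f (xi i j)).
  pose hi i j := if b i j then xi i j else xi' i j.
  pose lo i j := if b i j then xi' i j else xi i j.
  have thi : Defs.tagged p q hi.
    by move=> i j ip jq; rewrite /hi; case: (b i j); [exact: tp|exact: tq].
  have tlo : Defs.tagged p q lo.
    by move=> i j ip jq; rewrite /lo; case: (b i j); [exact: tq|exact: tp].
  have -> : \sum_(i < size p) \sum_(j < size q) cell_area p q i j *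
      `|F (f (xi i j)) - F (f (xi' i j))| =
      F (riemann_sum2 f p q hi - riemann_sum2 f p q lo).
    rewrite sF; apply: eq_bigr => i _; apply: eq_bigr => j _; congr (_ * _).
    rewrite /hi /lo; case: ifPn; rewrite /b => h;
      first by rewrite ger0_norm ?subr_ge0.
    by rewrite ltr0_norm ?opprB// subr_lt0 ltNge.
  apply: le_trans (ler_norm _) _; apply: le_trans (hF _) _.
  have -> : riemann_sum2 f p q hi - riemann_sum2 f p q lo =
     (riemann_sum2 f p q hi - I) + (I - riemann_sum2 f p q lo) by ring.
  apply: le_trans (le_normcD _ _) _.
  rewrite (normcB I) mulr_natl mulr2n.
  by rewrite lerD ?ltW// hd.
have hRe := osc _ normc_ge_absRe (Re_riemann_sum2B f p q).
have hIm := osc _ normc_ge_absIm (Im_riemann_sum2B f p q).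
have -> : 4 * e = 2 * e + 2 * e by ring.
apply: le_trans (lerD hRe hIm).
rewrite -big_split /=; apply: ler_sum => i _.
rewrite -big_split /=; apply: ler_sum => j _.
rewrite -mulrDr ler_wpM2l ?mulr_ge0 ?itv_partition_step//.
by rewrite -cReB -cImB normc_leReIm.
Qed.

Definition grid_point n (k : 'I_(n * n)) : R * R :=
  ((idx1 k)%:R * hstep n, (idx2 k)%:R * hstep n).

Definition uniform_grid (n : nat) : seq R :=
  [seq i.+1%:R * hstep n | i <- iota 0 n.+1].

Lemma size_uniform_grid n : size (uniform_grid n) = n.+1.
Proof. by rewrite size_map size_iota. Qed.

Lemma hstep_gt0 n : 0 < hstep n :> R.
Proof. by rewrite invr_gt0 ltr0n. Qed.

Lemma nth_uniform_grid n i : (i < n.+1)%N ->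
  nth 1 (uniform_grid n) i = i.+1%:R * hstep n.
Proof. by move=> h; rewrite (nth_map 0%N) ?size_iota// nth_iota. Qed.

Lemma nth_uniform_grid0 n i : (i < n.+1)%N ->
  nth 1 (0 :: uniform_grid n) i = i%:R * hstep n.
Proof.
by case: i => [|i] h; [rewrite /= mul0r|rewrite /= nth_uniform_grid// ltnW].
Qed.

Lemma uniform_grid_step n i : (i < n.+1)%N ->
  nth 1 (uniform_grid n) i - nth 1 (0 :: uniform_grid n) i = hstep n.
Proof.
move=> h; rewrite nth_uniform_grid// nth_uniform_grid0//.
by rewrite -mulrBl -natr1 addrAC subrr add0r mul1r.
Qed.

Lemma uniform_grid_partition n : itv_partition 0 1 (uniform_grid n).
Proof.
split.
  apply/(pathP 1) => i; rewrite size_uniform_grid => h.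
  by rewrite -subr_gt0 uniform_grid_step// hstep_gt0.
rewrite (last_nth 1) size_uniform_grid /= nth_uniform_grid//.
by rewrite /hstep mulfV.
Qed.

(** Half-open, so that distinct cells are disjoint and the sample point
    attached to a cell, its upper right corner, belongs to it. *)
Definition grid_cell n (i j : nat) : set (R * R) :=
  `]i%:R * hstep n, i.+1%:R * hstep n] `*` `]j%:R * hstep n, j.+1%:R * hstep n].

Definition cell_of n (k : 'I_(n * n)) := grid_cell n (k %/ n) (k %% n).

Lemma measurable_cell n i j :
  measurable (grid_cell n i j : set (measurableTypeR R * measurableTypeR R)).
Proof. by apply: measurableX; exact: measurable_itv. Qed.

Lemma leb2_cell n i j : leb2 (grid_cell n i j) = ((hstep n) ^+ 2)%:E.
Proof.
have side (k : nat) : @lebesgue_measure R `]k%:R * hstep n, k.+1%:R * hstep n] =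
    (hstep n)%:E.
  rewrite lebesgue_measure_itv /= lte_fin ltr_pM2r ?hstep_gt0// ltr_nat ltnSn.
  by rewrite -EFinB -mulrBl -natr1 addrAC subrr add0r mul1r.
rewrite /leb2 product_measure1E; [|exact: measurable_itv|exact: measurable_itv].
by rewrite expr2 EFinM; congr (_ * _)%E; exact: side.
Qed.

Lemma idx_lt n (k : 'I_(n * n)) : (k %/ n < n)%N /\ (k %% n < n)%N.
Proof.
have n0 : (0 < n)%N by case: n k => [[]//|].
by rewrite ltn_divLR// ltn_mod n0.
Qed.

Lemma itv_grid_inj n i j (x : R) :
  x \in `]i%:R * hstep n, i.+1%:R * hstep n]%R ->
  x \in `]j%:R * hstep n, j.+1%:R * hstep n]%R -> i = j.
Proof.
rewrite !in_itv /= => /andP[a1 a2] /andP[b1 b2].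
have := lt_le_trans a1 b2; have := lt_le_trans b1 a2.
rewrite !ltr_pM2r ?hstep_gt0// !ltr_nat !ltnS => h1 h2.
by apply/eqP; rewrite eqn_leq h1 h2.
Qed.

Lemma trivIset_cell n : trivIset [set: 'I_(n * n)] (@cell_of n).
Proof.
move=> k l _ _ [x [[/= a1 a2] [/= b1 b2]]].
apply: val_inj; rewrite /= (divn_eq k n) (divn_eq l n).
by rewrite (itv_grid_inj a1 b1) (itv_grid_inj a2 b2).
Qed.

Lemma cell_sub_square n (k : 'I_(n * n)) : cell_of k `<=` square.
Proof.
have [h1 h2] := idx_lt k.
have key i : (i < n)%N -> `]i%:R * hstep n, i.+1%:R * hstep n] `<=` (`[0, 1] :
  set R).
  move=> iN x /=; rewrite !in_itv /= => /andP[a b].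
  rewrite (le_trans _ (ltW a)) ?mulr_ge0 ?(ltW (hstep_gt0 n))//=.
  by rewrite (le_trans b)// /hstep ler_pdivrMr// mul1r ler_nat ltnS ltnW.
by move=> x [a b]; split; [exact: key h1 _ a|exact: key h2 _ b].
Qed.

(** Let a cell be bad if its corner is a sample of modulus above M. Either
    |mu| >= M / 2 on the whole cell, or it contains a point where the truncation
    of mu differs by at least M / 2 from its value M at the corner. Small
    oscillation makes the cells of the second kind occupy little area, so those
    of the first kind occupy most of the area of the bad cells. *)
Lemma large_on_cells (mu : R * R -> C) (M eps : R) : 0 < M -> 0 < eps ->
  riemann_integrable_square (trunc_fun M mu) ->
  (forall n0, exists2 n, (n0 <= n)%N &
    eps * (n * n)%:R <
      #|[set k : 'I_(n * n) | M < normc (mu (grid_point k))]%SET|%:R) ->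
  exists E : set (measurableTypeR R * measurableTypeR R),
    [/\ measurable E, E `<=` square,
        forall x, E x -> M / 2 <= normc (mu x) & ((eps / 8)%:E <= leb2 E)%E].
Proof.
move=> M0 eps0 hM hbad.
(* This tolerance leaves, for the cells of the second kind, an area of at most
   4 (M eps / 64) / (M / 2) = eps / 8. *)
have e0 : 0 < M * eps / 64 by rewrite divr_gt0// mulr_gt0.
have [delta d0 hd] := riemann_oscillation hM e0.
pose n0 := (Num.truncn (delta^-1)).+1.
have [n nn0] := hbad n0; set Bad := finset.finset _ => hn.
have n_gt0 : (0 < n)%N by exact: leq_trans nn0.
have hdelta : hstep n < delta.
  rewrite /hstep -[delta]invrK ltf_pV2 ?posrE ?invr_gt0 ?ltr0n//.
  apply: (lt_le_trans (truncnS_gt _)); rewrite ler_nat.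
  by rewrite (leq_trans nn0).
have mesh : mesh_lt (uniform_grid n) delta.
  by move=> i; rewrite size_uniform_grid => h; rewrite uniform_grid_step.
pose corner i j : R * R := (i.+1%:R * hstep n, j.+1%:R * hstep n).
pose small i j : set (R * R) :=
  [set x | grid_cell n i j x /\ normc (mu x) < M / 2].
(* The corner itself is the tag in the cells where |mu| is never small. *)
pose low i j := xget (corner i j) (small i j).
have corner_cell i j : grid_cell n i j (corner i j).
  by split; rewrite /= in_itv /= lexx andbT ltr_pM2r ?hstep_gt0// ltr_nat.
have low_cell i j : grid_cell n i j (low i j).
  by rewrite /low; case: xgetP => [x _ []|].
have tag xi : (forall i j, grid_cell n i j (xi i j)) ->
    Defs.tagged (uniform_grid n) (uniform_grid n) xi.
  move=> h i j; rewrite size_uniform_grid => iN jN.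
  rewrite !nth_uniform_grid// !nth_uniform_grid0//.
  have [] := h i j; rewrite /= !in_itv /= => /andP[/ltW h1 h2].
  by move=> /andP[/ltW h3 h4]; split; apply/andP.
have := hd _ _ _ _ (uniform_grid_partition n) (uniform_grid_partition n)
  mesh mesh (tag _ corner_cell) (tag _ low_cell).
rewrite size_uniform_grid.
set osc := fun i j =>
  normc (trunc_fun M mu (corner i j) - trunc_fun M mu (low i j)).
under eq_bigr => i _.
  under eq_bigr => j _ do
    rewrite /cell_area !uniform_grid_step// -expr2 -/(osc i j).
  over.
rewrite pair_big /= => hosc.
pose Good : {set 'I_(n * n)} := [set k in Bad |
   `[< forall x, cell_of k x -> M / 2 <= normc (mu x) >]]%SET.
have BG k : k \in Bad :\: Good -> M / 2 <= osc (k %/ n)%N (k %% n)%N.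
  rewrite finset.in_setD inE => /andP[kG kB]; rewrite kB /= in kG.
  have kM : M < normc (mu (corner (k %/ n)%N (k %% n)%N)) by move: kB;
    rewrite inE.
  move/asboolPn : kG => /existsNP[x /not_implyP[kx]] /negP;
    rewrite -ltNge => mux.
  have [_ lowM] : small (k %/ n)%N (k %% n)%N (low (k %/ n)%N (k %% n)%N).
    by apply: xgetPex; exists x.
  have -> : osc (k %/ n)%N (k %% n)%N =
      normc (M%:C - mu (low (k %/ n)%N (k %% n)%N)).
    rewrite /osc /trunc_fun [normc (mu (corner _ _)) <= M]leNgt kM /=.
    by rewrite ifT //; apply/ltW/(lt_trans lowM); lra.
  apply: le_trans (normc_lerB _ _).
  by rewrite normc_real gtr0_norm//; lra.
pose phi (k : 'I_(n * n)) : 'I_n.+1 * 'I_n.+1 :=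
  (inord (k %/ n), inord (k %% n)).
have phiE k : (phi k).1 = (k %/ n)%N :> nat /\ (phi k).2 = (k %% n)%N :> nat.
  by have [h1 h2] := idx_lt k; split; rewrite /= inordK// ltnS ltnW.
have phi_inj : injective phi.
  move=> k l kl; have [k1 k2] := phiE k; have [l1 l2] := phiE l.
  apply: val_inj; rewrite /= (divn_eq k n) (divn_eq l n).
  by rewrite -k1 -k2 -l1 -l2 kl.
have hBG : (hstep n) ^+ 2 * (M / 2 * #|Bad :\: Good|%:R) <= M * eps / 16.
  apply: (@le_trans _ _ (\sum_(x :
    'I_n.+1 * 'I_n.+1) hstep n ^+ 2 * osc x.1 x.2)).
    apply: (@le_trans _ _ (\sum_(x in [set phi k | k in Bad :\: Good]%SET)
         hstep n ^+ 2 * osc x.1 x.2)); last first.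
      rewrite [leRHS](bigID (mem [set phi k | k in Bad :\: Good]%SET)) /= lerDl.
      by apply: sumr_ge0 => x _; rewrite mulr_ge0 ?sqr_ge0 ?normc_ge0.
    rewrite big_imset /=; last by move=> k l _ _; exact: phi_inj.
    rewrite -mulr_sumr ler_pM2l ?exprn_gt0 ?hstep_gt0//.
    rewrite mulr_natr -sumr_const; apply: ler_sum => k kBG.
    by have [-> ->] := phiE k; exact: BG.
  by apply: le_trans hosc _; rewrite le_eqVlt; apply/orP; left; apply/eqP;
    field.
exists (\big[setU/set0]_(k < n * n | k \in Good) cell_of k); split.
- by apply: bigsetU_measurable => k _; exact: measurable_cell.
- elim/big_ind : _ => [x []|A B hA hB|k _]; last exact: cell_sub_square.
  by rewrite subUset.
- move=> x; elim/big_ind : _ => [[]|A B hA hB []//|k].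
  by rewrite inE => /andP[_ /asboolP]; exact.
rewrite measure_bigsetU_ord; last 2 first.
- by move=> k; exact: measurable_cell.
- exact: trivIset_cell.
rewrite (eq_bigr (fun=> ((hstep n) ^+ 2)%:E)); last by move=> k _;
  exact: leb2_cell.
rewrite sumEFin lee_fin sumr_const -[hstep n ^+ 2 *+ _]mulr_natr.
have cardBad : #|Bad|%:R = #|Good|%:R + #|Bad :\: Good|%:R :> R.
  rewrite -natrD -(cardsID Good Bad); congr (_ + _)%:R.
  by apply: eq_card => k; rewrite !inE; case: (M < _).
(* The cells whose corner is a sample fill (n h)^2 >= 1 / 4 of the square. *)
have nh : 1 / 2 <= n%:R * hstep n :> R.
  rewrite /hstep ler_pdivlMr ?ltr0n// -[n.+1%:R]natr1.
  have : 1 <= n%:R :> R by rewrite ler1n.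
  lra.
have nh2 : 1 / 4 <= hstep n ^+ 2 * (n * n)%:R :> R.
  by rewrite natrM; nra.
have h0 : 0 < hstep n ^+ 2 :> R by rewrite exprn_gt0// hstep_gt0.
have hb : eps * (1 / 4) <= hstep n ^+ 2 * #|Bad|%:R.
  have := ltW hn; rewrite -(ler_pM2l h0); apply: le_trans.
  by rewrite [leRHS]mulrCA ler_pM2l.
have hg : hstep n ^+ 2 * #|Bad :\: Good|%:R <= eps / 8.
  rewrite -(ler_pM2l (_ : 0 < M / 2)) ?divr_gt0//.
  by rewrite mulrCA (le_trans hBG)// le_eqVlt; apply/orP; left; apply/eqP;
    field.
by move: hb; rewrite cardBad mulrDr; lra.
Qed.

(** Otherwise [large_on_cells] produces, at every level m, a set of measure at
    least eps / 8 on which |mu| >= (m + 1) / 2. Their upper limit would then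
    have positive measure, while no finite value of mu allows a point to belong
    to it. *)
Lemma few_large_values (mu : R * R -> C)
    (hriemann : forall M, 0 < M -> riemann_integrable_square (trunc_fun M mu))
    (eps : R) : 0 < eps ->
  exists2 M : R, 0 < M & exists n0, forall n, (n0 <= n)%N ->
    #|[set k : 'I_(n * n) | M < normc (mu (grid_point k))]%SET|%:R <=
      eps * (n * n)%:R.
Proof.
move=> eps0; apply: contrapT => hno.
have hE (m : nat) : exists E : set (measurableTypeR R * measurableTypeR R),
    [/\ measurable E, E `<=` square,
        forall x, E x -> m.+1%:R / 2 <= normc (mu x) &
        ((eps / 8)%:E <= leb2 E)%E].
  apply: large_on_cells => //; first exact: hriemann.
  move=> n0; apply: contrapT => hn0; apply: hno; exists m.+1%:R => //.
  exists n0 => n nn0; rewrite leNgt; apply/negP => h; apply: hn0.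
  by exists n.
have [E /all_and4[mE sE lE eE]] := choice hE.
have mS : measurable (square : set (measurableTypeR R * measurableTypeR R)).
  by apply: measurableX; exact: measurable_itv.
have E0 : lim_sup_set E = set0.
  rewrite -subset0 => x hx.
  have [k /= mk Ek] := hx (Num.truncn (2 * normc (mu x))) I.
  have := lE _ _ Ek; rewrite leNgt => /negP; apply.
  rewrite ltr_pdivlMr// mulrC; apply: (lt_le_trans (truncnS_gt _)).
  by rewrite ler_nat.
have fin : (leb2 (\bigcup_(k >= 0) E k) < +oo)%E.
  apply: (@le_lt_trans _ _ (leb2 (square :
    set (measurableTypeR R * measurableTypeR R)))).
    apply: le_measure; rewrite ?inE//; first exact: bigcup_measurable.
    by apply: bigcup_sub => k _; exact: sE.
  rewrite /leb2 product_measure1E;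
    [|exact: measurable_itv|exact: measurable_itv].
  by apply: lte_mul_pinfty => //; rewrite ?ge0_fin_numE //=
    lebesgue_measure_itv /= lte_fin ltr01 -EFinB ltry.
have := lim_sup_set_cvg leb2 E mE fin; rewrite E0 measure0.
move=> /fine_cvgP[_ /cvgrPdist_lt /(_ (eps / 8)) []]; first by rewrite divr_gt0.
move=> m _ /(_ m (leqnn m)) /=; rewrite sub0r normrN ltNge => /negP; apply.
rewrite ger0_norm ?fine_ge0 ?measure_ge0//.
have fin' : (leb2 (\bigcup_(k in [set k | (m <= k)%N]) E k) < +oo)%E.
  apply: le_lt_trans fin; apply: le_measure; rewrite ?inE//;
    try exact: bigcup_measurable.
  by apply: bigcup_sub => k _; exact: bigcup_sup.
rewrite -lee_fin fineK ?ge0_fin_numE ?measure_ge0//.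
apply: le_trans (eE m) _.
apply: le_measure; rewrite ?inE//; first exact: bigcup_measurable.
by apply: bigcup_sup => /=.
Qed.

End GridSamples.

(** * Means over the torus *)

Section TorusMean.
Context {R : realType}.
Local Notation C := R[i].
Local Notation T2 := (measurableTypeR R * measurableTypeR R)%type.

Lemma integral_cos_period (k c : R) : k != 0 -> sin (k * pi) = 0 ->
  (\int[@lebesgue_measure R]_(x in `[(- pi)%R, pi]) (cos (k * x + c))%:E)%E =
    0%E.
Proof.
move=> k0 skpi; pose F (x : R) : R := k^-1 * sin (k * x + c).
have dF (x : R) : is_derive x (1 : R) F (cos (k * x + c)).
  rewrite /F; apply: is_derive_eq; rewrite /GRing.scale /=.
  by rewrite addr0 mulr1 mulrCA mulVf// mulr1.
have cF (x : R) : {for x, continuous F}.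
  by apply: differentiable_continuous; apply/derivable1_diffP; case: (dF x).
rewrite (@continuous_FTC2 _ _ F).
- have -> : F pi = F (- pi).
    by rewrite /F mulrN !sinD cosN sinN skpi oppr0 !mul0r !add0r.
  by rewrite -EFinB subrr.
- by have := pi_gt0 R; lra.
- apply: continuous_subspaceT => x.
  apply: continuous_comp; last exact: continuous_cos.
  by apply: continuousD; [exact: mulrl_continuous|exact: cst_continuous].
- split; first by move=> x _; case: (dF x).
    exact/cvg_at_right_filter/cF.
  exact/cvg_at_left_filter/cF.
- by move=> x _; rewrite derive1E; case: (dF x).
Qed.

Lemma sin_int_pi (k : int) : sin (k%:~R * pi) = 0 :> R.
Proof.
have h (n : nat) : sin (n%:R * pi) = 0 :> R.
  elim: n => [|n IH]; first by rewrite mul0r sin0.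
  by rewrite -natr1 mulrDl mul1r sinDpi IH oppr0.
case: k => n; first exact: h.
by rewrite NegzE mulrNz mulNr sinN (h n.+1) oppr0.
Qed.

Lemma measurable_torus : measurable (torus : set T2).
Proof. by apply: measurableX; exact: measurable_itv. Qed.

Lemma leb2_torus : leb2 (torus : set T2) = ((2 * pi) ^+ 2)%:E.
Proof.
have side : @lebesgue_measure R `[- pi, pi] = (2 * pi)%:E.
  rewrite lebesgue_measure_itv /= lte_fin ifT; last by have := pi_gt0 R; lra.
  by rewrite -EFinB; congr (_%:E); ring.
rewrite /leb2 product_measure1E; [|exact: measurable_itv|exact: measurable_itv].
by rewrite expr2 EFinM; congr (_ * _)%E; exact: side.
Qed.

Lemma leb2_torus_fin : (leb2 (torus : set T2) < +oo)%E.
Proof. by rewrite leb2_torus ltry. Qed.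

(** A class that is stable under ring operations and whose members are
    integrable on the torus, so that integrability reduces to closure lemmas. *)
Definition bborel (f : T2 -> R) : Prop :=
  measurable_fun setT f /\ exists B : R, forall x, `|f x| <= B.

Lemma bborel_integrable f : bborel f ->
  leb2.-integrable (torus : set T2) (EFin \o f).
Proof.
move=> [mf [B hB]]; apply: measurable_bounded_integrable.
- exact: measurable_torus.
- exact: leb2_torus_fin.
- exact: measurable_funTS.
- exists B; split; first exact: num_real.
  by move=> y By x _; rewrite /= (le_trans (hB x))// ltW.
Qed.

Lemma bborelD f g : bborel f -> bborel g -> bborel (fun x => f x + g x).
Proof.
move=> [mf [B hB]] [mg [D hD]]; split; first exact: measurable_funD.
by exists (B + D) => x; apply: le_trans (ler_normD _ _) (lerD (hB x) (hD x)).
Qed.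

Lemma bborelM f g : bborel f -> bborel g -> bborel (fun x => f x * g x).
Proof.
move=> [mf [B hB]] [mg [D hD]]; split; first exact: measurable_funM.
by exists (B * D) => x; rewrite normrM ler_pM.
Qed.

Lemma bborel_cst (c : R) : bborel (fun=> c).
Proof. by split; [exact: measurable_cst|exists `|c|]. Qed.

Lemma bborelN f : bborel f -> bborel (fun x => - f x).
Proof.
move=> hf; have -> : (fun x => - f x) = (fun x => -1 * f x).
  by apply/funext => x; rewrite mulN1r.
exact: bborelM (bborel_cst _) hf.
Qed.

Lemma bborelB f g : bborel f -> bborel g -> bborel (fun x => f x - g x).
Proof. by move=> hf hg; apply: bborelD => //; exact: bborelN. Qed.

Lemma bborel_cos (a b c : R) : bborel (fun t => cos (a * t.1 + b * t.2 + c)).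
Proof.
split; last by exists 1 => x; rewrite ler_norml cos_geN1 cos_le1.
apply: measurableT_comp;
  first exact: (continuous_measurable_fun (@continuous_cos R)).
apply: measurable_funD => //; apply: measurable_funD.
  by apply: measurable_funM => //; exact: measurable_fst.
by apply: measurable_funM => //; exact: measurable_snd.
Qed.

Lemma bborel_sin (a b c : R) : bborel (fun t => sin (a * t.1 + b * t.2 + c)).
Proof.
have -> : (fun t : T2 => sin (a * t.1 + b * t.2 + c)) =
          (fun t => cos (a * t.1 + b * t.2 + (c - pi / 2))).
  by apply/funext => t; rewrite addrA cosBpihalf.
exact: bborel_cos.
Qed.

Definition torus_mean (f : R * R -> R) : R :=
  (2 * pi) ^- 2 * Rintegral leb2 (torus : set T2) f.

Lemma torus_meanD f g : bborel f -> bborel g ->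
  torus_mean (fun x => f x + g x) = torus_mean f + torus_mean g.
Proof.
move=> hf hg; rewrite /torus_mean RintegralD ?mulrDr//.
- exact: measurable_torus.
- exact: bborel_integrable.
- exact: bborel_integrable.
Qed.

Lemma torus_meanZ c f : bborel f -> torus_mean (fun x => c * f x) =
  c * torus_mean f.
Proof.
move=> hf; rewrite /torus_mean RintegralZl 1?mulrCA//.
- exact: measurable_torus.
- exact: bborel_integrable.
Qed.

Lemma torus_meanN f : bborel f -> torus_mean (fun x => - f x) = - torus_mean f.
Proof.
move=> hf; rewrite -mulN1r -torus_meanZ//; congr torus_mean; apply/funext => x.
by rewrite mulN1r.
Qed.

Lemma torus_meanB f g : bborel f -> bborel g ->
  torus_mean (fun x => f x - g x) = torus_mean f - torus_mean g.
Proof. by move=> hf hg; rewrite torus_meanD ?torus_meanN//; exact: bborelN. Qed.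

Lemma torus_mean_cst (c : R) : torus_mean (fun=> c) = c.
Proof.
rewrite /torus_mean Rintegral_cst; last exact: measurable_torus.
rewrite (_ : fine _ = (2 * pi) ^+ 2); last exact: (congr1 fine leb2_torus).
rewrite mulrCA mulVf ?mulr1// expf_neq0// mulf_neq0//.
by rewrite gt_eqF// pi_gt0.
Qed.

Lemma torus_mean_le f g : bborel f -> bborel g ->
  (forall x, torus x -> f x <= g x) ->
  torus_mean f <= torus_mean g.
Proof.
move=> hf hg fg; rewrite /torus_mean ler_wpM2l ?invr_ge0 ?sqr_ge0//.
apply: le_Rintegral => //.
- exact: measurable_torus.
- exact: bborel_integrable.
- exact: bborel_integrable.
Qed.

Lemma torus_mean_close f g (e : R) : bborel f -> bborel g ->
  (forall x, torus x -> `|f x - g x| <= e) -> `|torus_mean f - torus_mean g| <=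
    e.
Proof.
move=> hf hg fg; rewrite -torus_meanB// ler_norml -{1}(torus_mean_cst (- e))
  -{2}(torus_mean_cst e).
have hfg := bborelB hf hg.
by apply/andP; split; apply: torus_mean_le => //; try exact: bborel_cst;
  move=> x /fg; rewrite ler_norml => /andP[].
Qed.

(** Fubini, integrating first in a variable with nonzero frequency: the inner
    integral runs over full periods. The phase c also covers the sine. *)
Lemma torus_mean_cos (k1 k2 : int) (c : R) : (k1, k2) != (0, 0) ->
  torus_mean (fun t => cos (k1%:~R * t.1 + k2%:~R * t.2 + c)) = 0.
Proof.
move=> k0; rewrite /torus_mean.
set f := fun t : R * R => _.
have hf : bborel f by exact: bborel_cos.
rewrite Rintegral_mkcond /Rintegral.
have If : leb2.-integrable setT (EFin \o (f \_ (torus : set T2))).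
  rewrite -restrict_EFin; apply/integrable_restrict; rewrite ?setTI//.
    exact: measurable_torus.
  exact: bborel_integrable.
suff -> : (\int[leb2]_x (EFin \o (f \_ (torus : set T2))) x = 0)%E
  by rewrite mulr0.
have [k1_0|k1_0] := eqVneq k1 0.
  have k2_0 : k2 != 0 by move: k0; rewrite k1_0; apply: contra_neq => ->.
  rewrite /leb2 -(integral12_prod_meas1 If).
  apply: integral0_eq => x _; rewrite /fubini_F /=.
  have [xI|xI] := boolP (x \in `[- pi, pi]%R).
    rewrite -[RHS](@integral_cos_period k2%:~R (k1%:~R * x + c)) ?intr_eq0
      ?sin_int_pi//.
    rewrite [RHS]integral_mkcond; apply: eq_integral => y _ /=.
    rewrite !patchE /torus;
      have -> : ((x, y) \in (`[- pi, pi] `*` `[- pi, pi] : set T2)) =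
      (y \in (`[- pi, pi] : set R)).
      by rewrite in_setX /= !mem_setE xI.
    by case: ifP => // _; rewrite /f /=; congr (cos _)%:E; ring.
  apply: integral0_eq => y _; rewrite patchE ifF//.
  by apply/negbTE; rewrite in_setX /= mem_setE (negbTE xI).
rewrite /leb2 -(integral21_prod_meas1 If).
apply: integral0_eq => y _; rewrite /fubini_G /=.
have [yI|yI] := boolP (y \in `[- pi, pi]%R).
  rewrite -[RHS](@integral_cos_period k1%:~R (k2%:~R * y + c)) ?intr_eq0
    ?sin_int_pi//.
  rewrite [RHS]integral_mkcond; apply: eq_integral => x _ /=.
  rewrite !patchE /torus;
    have -> : ((x, y) \in (`[- pi, pi] `*` `[- pi, pi] : set T2)) =
    (x \in (`[- pi, pi] : set R)).
    by rewrite in_setX /= !mem_setE yI andbT.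
  by case: ifP => // _; rewrite /f /=; congr (cos _)%:E; ring.
apply: integral0_eq => x _; rewrite patchE ifF//.
by apply/negbTE; rewrite in_setX /= !mem_setE (negbTE yI) andbF.
Qed.

End TorusMean.

(** * Fourier modes and the norm of Toeplitz matrices *)

Section ToeplitzNorm.
Context {R : realType}.
Local Notation C := R[i].
Local Notation cj := (@conjc R).
Local Notation T2 := (measurableTypeR R * measurableTypeR R)%type.

Lemma expiD (a b : R) : expi (a + b) = expi a * expi b :> C.
Proof.
rewrite /expi cosD sinD; apply/eqP; rewrite eq_complex /=.
by rewrite eqxx addrC [X in _ + X]mulrC eqxx.
Qed.

Lemma expi0 : expi 0 = 1 :> C.
Proof. by rewrite /expi cos0 sin0. Qed.

Lemma expiN (a : R) : expi (- a) = cj (expi a) :> C.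
Proof. by rewrite /expi cosN sinN. Qed.

Lemma expi_expn (a : R) n : expi (n%:R * a) = expi a ^+ n :> C.
Proof.
elim: n => [|n IH]; first by rewrite mul0r expi0.
by rewrite exprS -IH -expiD -natr1; congr expi; ring.
Qed.

Definition emode (k : int * int) (t : R * R) : C :=
  expi (k.1%:~R * t.1 + k.2%:~R * t.2).

Arguments emode : simpl never.

Lemma emodeD k l t : emode (k + l) t = emode k t * emode l t.
Proof. by rewrite /emode -expiD /= !intrD; congr expi; ring. Qed.

Lemma emode0 t : emode 0 t = 1.
Proof. by rewrite /emode /= !mul0r addr0 expi0. Qed.

Lemma emodeN k t : emode (- k) t = cj (emode k t).
Proof. by rewrite /emode -expiN /= !mulrNz; congr expi; ring. Qed.

Definition cborel (f : R * R -> C) : Prop :=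
  bborel (fun t => complex.Re (f t)) /\ bborel (fun t => complex.Im (f t)).

Definition torus_cmean (f : R * R -> C) : C :=
  torus_mean (fun t => complex.Re (f t)) +i* torus_mean (fun t =>
    complex.Im (f t)).

Lemma cReD (x y : C) : complex.Re (x + y) = complex.Re x + complex.Re y.
Proof. by case: x; case: y. Qed.
Lemma cImD (x y : C) : complex.Im (x + y) = complex.Im x + complex.Im y.
Proof. by case: x; case: y. Qed.
Lemma cReM (x y : C) : complex.Re (x * y) =
  complex.Re x * complex.Re y - complex.Im x * complex.Im y.
Proof. by case: x; case: y. Qed.
Lemma cImM (x y : C) : complex.Im (x * y) =
  complex.Re x * complex.Im y + complex.Im x * complex.Re y.
Proof. by case: x => a b; case: y => c d /=; rewrite [b * c]mulrC. Qed.
Lemma cRe_conj (x : C) : complex.Re (cj x) = complex.Re x.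
Proof. by case: x. Qed.
Lemma cIm_conj (x : C) : complex.Im (cj x) = - complex.Im x.
Proof. by case: x. Qed.
Lemma complex_ext (x y : C) : complex.Re x = complex.Re y ->
  complex.Im x = complex.Im y -> x = y.
Proof. by case: x => a b; case: y => c d /= -> ->. Qed.

Lemma cjM (x y : C) : cj (x * y) = cj x * cj y.
Proof. exact: (rmorphM (@conjc R)). Qed.
Lemma cj_sum (I : Type) (s : seq I) (F : I -> C) :
  cj (\sum_(i <- s) F i) = \sum_(i <- s) cj (F i).
Proof. exact: (raddf_sum (@conjc R)). Qed.

Lemma cborelD f g : cborel f -> cborel g -> cborel (fun t => f t + g t).
Proof.
move=> [fr fi] [gr gi]; split.
  by under eq_fun do rewrite cReD; exact: bborelD.
by under eq_fun do rewrite cImD; exact: bborelD.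
Qed.

Lemma cborelM f g : cborel f -> cborel g -> cborel (fun t => f t * g t).
Proof.
move=> [fr fi] [gr gi]; split.
  by under eq_fun do rewrite cReM; apply: bborelB; exact: bborelM.
by under eq_fun do rewrite cImM; apply: bborelD; exact: bborelM.
Qed.

Lemma cborel_cst (c : C) : cborel (fun=> c).
Proof. by split; exact: bborel_cst. Qed.

Lemma cborel_conj f : cborel f -> cborel (fun t => cj (f t)).
Proof.
move=> [fr fi]; split; first by under eq_fun do rewrite cRe_conj.
by under eq_fun do rewrite cIm_conj; exact: bborelN.
Qed.

Lemma cborel_sum (I : Type) (s : seq I) (f : I -> R * R -> C) :
  (forall i, cborel (f i)) -> cborel (fun t => \sum_(i <- s) f i t).
Proof.
move=> hf; elim: s => [|i s IH].
  by under eq_fun do rewrite big_nil; exact: cborel_cst.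
by under eq_fun do rewrite big_cons; exact: cborelD.
Qed.

Lemma cborel_emode k : cborel (emode k).
Proof.
split; rewrite /emode /expi /=.
  by have := bborel_cos (k.1%:~R : R) k.2%:~R 0; under eq_fun do rewrite addr0.
by have := bborel_sin (k.1%:~R : R) k.2%:~R 0; under eq_fun do rewrite addr0.
Qed.

Lemma torus_cmeanD f g : cborel f -> cborel g ->
  torus_cmean (fun t => f t + g t) = torus_cmean f + torus_cmean g.
Proof.
move=> [fr fi] [gr gi]; apply: complex_ext => /=.
  by under eq_fun do rewrite cReD; exact: torus_meanD.
by under eq_fun do rewrite cImD; exact: torus_meanD.
Qed.

Lemma torus_cmeanZ c f : cborel f -> torus_cmean (fun t => c * f t) =
  c * torus_cmean f.
Proof.
move=> [fr fi]; apply: complex_ext.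
  rewrite cReM /=; under eq_fun do rewrite cReM.
  by rewrite torus_meanB ?torus_meanZ//; apply: bborelM => //;
    exact: bborel_cst.
rewrite cImM /=; under eq_fun do rewrite cImM.
by rewrite torus_meanD ?torus_meanZ//; apply: bborelM => //; exact: bborel_cst.
Qed.

Lemma torus_cmean0 : torus_cmean (fun=> 0) = 0.
Proof. by rewrite /torus_cmean /= !torus_mean_cst. Qed.

Lemma torus_cmean_sum (I : Type) (s : seq I) (f : I -> R * R -> C) :
  (forall i, cborel (f i)) ->
  torus_cmean (fun t => \sum_(i <- s) f i t) = \sum_(i <- s) torus_cmean (f i).
Proof.
move=> hf; elim: s => [|i s IH].
  by under eq_fun do rewrite big_nil; rewrite big_nil torus_cmean0.
under eq_fun do rewrite big_cons.
by rewrite big_cons -IH torus_cmeanD //; exact: cborel_sum.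
Qed.

Lemma torus_cmean_conj f : cborel f -> torus_cmean (fun t => cj (f t)) =
  cj (torus_cmean f).
Proof.
move=> [fr fi]; apply: complex_ext.
  by rewrite cRe_conj /=; congr torus_mean; apply/funext => t; rewrite cRe_conj.
by rewrite cIm_conj /= -torus_meanN//; congr torus_mean; apply/funext => t;
  rewrite cIm_conj.
Qed.

Lemma torus_cmean_emode k : torus_cmean (emode k) = (k == 0)%:R.
Proof.
have [->|k0] := eqVneq k 0.
  have -> : emode 0 = fun=> 1 by apply/funext => t; rewrite emode0.
  by rewrite /torus_cmean /= !torus_mean_cst.
case: k k0 => k1 k2 k0; apply: complex_ext => /=.
  by rewrite -[RHS](torus_mean_cos 0 k0); congr torus_mean; apply/funext => t;
    rewrite addr0.
rewrite -[RHS](torus_mean_cos (- (pi / 2)) k0); congr torus_mean;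
  apply/funext => t.
by rewrite cosBpihalf.
Qed.

Definition grid_index n (k : 'I_(n * n)) : int * int :=
  ((idx1 k)%:Z, (idx2 k)%:Z).

Lemma grid_index_inj n : injective (@grid_index n).
Proof.
move=> k l [] kl1 kl2; apply: val_inj => /=.
by rewrite (divn_eq k n) (divn_eq l n) kl1 kl2.
Qed.

Lemma toeplitzE n f r s : @toeplitz R n f r s =
  torus_cmean (fun t => f t * emode (grid_index s - grid_index r) t).
Proof.
rewrite mxE /fourier_coef /cintegral /torus_cmean /torus_mean /emode.
have E (t : R * R) : - (((idx1 r)%:Z - (idx1 s)%:Z)%:~R * t.1 +
            ((idx2 r)%:Z - (idx2 s)%:Z)%:~R * t.2) =
         (grid_index s - grid_index r).1%:~R * t.1 +
           (grid_index s - grid_index r).2%:~R * t.2.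
  by rewrite /grid_index /= !intrB; ring.
by apply: complex_ext; rewrite ?cReM ?cImM /= mul0r ?subr0 ?addr0;
  congr (_ * Rintegral _ _ _); apply/funext => t; rewrite E.
Qed.

Definition sqnorm d (v : 'rV[C]_d) : R := \sum_i normc (v 0 i) ^+ 2.

Lemma normcC (z : C) : `|z| = (normc z)%:C.
Proof. by []. Qed.

Lemma sqr_normcE (z : C) : (normc z ^+ 2)%:C = z * cj z.
Proof. by rewrite rmorphXn /= -normcC normCK. Qed.

Lemma vnorm_sqr d (v : 'rV[C]_d) : vnorm v ^+ 2 = (sqnorm v)%:C.
Proof.
rewrite /vnorm sqrtCK dotmx_sum /sqnorm rmorph_sum; apply: eq_bigr => i _.
by rewrite rmorphXn.
Qed.

Lemma vnorm_le d (u v : 'rV[C]_d) (B : R) : 0 <= B ->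
  sqnorm u <= B ^+ 2 * sqnorm v -> vnorm u <= B%:C * vnorm v.
Proof.
move=> B0 h; rewrite -(@ler_pXn2r _ 2) ?nnegrE ?mulr_ge0 ?vnorm_ge0 ?ler0c//.
by rewrite exprMn !vnorm_sqr -rmorphXn -rmorphM lecR.
Qed.

(** The sign of the frequencies is the one for which sesquilinear forms of
    Toeplitz matrices become means of products, in [toeplitz_norm]. *)
Definition trig_of_vec n (v : 'rV[C]_(n * n)) (t : R * R) : C :=
  \sum_s v 0 s * emode (- grid_index s) t.

Lemma cborel_trig_of_vec n (v : 'rV[C]_(n * n)) : cborel (trig_of_vec v).
Proof.
apply: cborel_sum => s; apply: cborelM; [exact: cborel_cst|exact: cborel_emode].
Qed.

Lemma cborel_norm2 f : cborel f -> bborel (fun t => normc (f t) ^+ 2).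
Proof.
move=> hf; have [h _] := cborelM hf (cborel_conj hf).
by move: h; under eq_fun do rewrite -sqr_normcE.
Qed.

(** The modes are orthonormal and distinct positions carry distinct
    frequencies. *)
Lemma parseval n (v : 'rV[C]_(n * n)) :
  torus_mean (fun t => normc (trig_of_vec v t) ^+ 2) = sqnorm v.
Proof.
have hV := cborel_trig_of_vec v.
suff /(congr1 (@complex.Re R)) :
  torus_cmean (fun t => trig_of_vec v t * cj (trig_of_vec v t)) = (sqnorm v)%:C.
  by rewrite /torus_cmean /=; under eq_fun do rewrite -sqr_normcE.
have -> : (fun t => trig_of_vec v t * cj (trig_of_vec v t)) =
   fun t => \sum_r \sum_s (v 0 r * cj (v 0 s)) * emode
     (grid_index s - grid_index r) t.
  apply/funext => t; rewrite /trig_of_vec cj_sum mulr_suml;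
    apply: eq_bigr => r _.
  rewrite mulr_sumr; apply: eq_bigr => s _.
  by rewrite emodeD cjM !emodeN conjcK; ring.
rewrite torus_cmean_sum; last first.
  move=> r; apply: cborel_sum => s; apply: cborelM;
    [exact: cborel_cst|exact: cborel_emode].
rewrite rmorph_sum /=; apply: eq_bigr => r _.
rewrite torus_cmean_sum; last first.
  by move=> s; apply: cborelM; [exact: cborel_cst|exact: cborel_emode].
rewrite (bigD1 r) //= big1 ?addr0.
  by rewrite torus_cmeanZ ?torus_cmean_emode ?subrr ?eqxx ?mulr1 ?sqr_normcE//;
    exact: cborel_emode.
move=> s sr; rewrite torus_cmeanZ ?torus_cmean_emode; last exact: cborel_emode.
by rewrite subr_eq0 (inj_eq (@grid_index_inj n)) (negbTE sr) mulr0.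
Qed.

(** With V and W the trigonometric polynomials of v and w = v T^*, the square
    of |w| is the mean of conj(g) V conj(W), at most that of
    (B^2 |V|^2 + |W|^2) / 2; by Parseval this is (B^2 |v|^2 + |w|^2) / 2, and
    half of |w|^2 is absorbed on the left. *)
Lemma toeplitz_norm n (g : R * R -> C) (B : R) : cborel g -> 0 <= B ->
  (forall t, torus t -> normc (g t) <= B) ->
  forall v : 'rV[C]_(n * n), vnorm (v *m (toeplitz n g)^t*) <= B%:C * vnorm v.
Proof.
move=> hg B0 gB v; set w := v *m _; apply: vnorm_le => //.
have hV := cborel_trig_of_vec v; have hW := cborel_trig_of_vec w.
pose F t := cj (g t) * (trig_of_vec v t * cj (trig_of_vec w t)).
have hF : cborel F by apply: cborelM; [exact: cborel_conj|apply: cborelM => //;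
  exact: cborel_conj].
have wE r : w 0 r = \sum_s v 0 s *
    torus_cmean (fun t => cj (g t) * emode (grid_index r - grid_index s) t).
  rewrite mxE; apply: eq_bigr => s _.
  have -> : ((toeplitz n g)^t*) s r = cj (toeplitz n g r s) by rewrite !mxE.
  rewrite toeplitzE -torus_cmean_conj; last first.
    by apply: cborelM => //; exact: cborel_emode.
  by congr (_ * torus_cmean _); apply/funext => t; rewrite cjM -emodeN opprB.
have key : (sqnorm w)%:C = torus_cmean F.
  have -> : F = fun t => \sum_r \sum_s
      (cj (w 0 r) * v 0 s) * (cj (g t) * emode (grid_index r - grid_index s) t).
    apply/funext => t; rewrite /F /trig_of_vec cj_sum mulr_sumr mulr_sumr.
    apply: eq_bigr => r _; rewrite mulr_suml mulr_sumr; apply: eq_bigr => s _.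
    by rewrite emodeD cjM !emodeN conjcK; ring.
  have hm r s : cborel (fun t =>
    cj (g t) * emode (grid_index r - grid_index s) t).
    by apply: cborelM; [exact: cborel_conj|exact: cborel_emode].
  rewrite torus_cmean_sum; last first.
    move=> r; apply: cborel_sum => s; apply: cborelM => //; exact: cborel_cst.
  rewrite /sqnorm rmorph_sum /=; apply: eq_bigr => r _.
  rewrite torus_cmean_sum; last by move=> s; apply: cborelM => //;
    exact: cborel_cst.
  rewrite sqr_normcE mulrC {2}wE mulr_sumr; apply: eq_bigr => s _.
  by rewrite torus_cmeanZ// mulrA.
have : sqnorm w <= torus_mean (fun t =>
  2^-1 * (B ^+ 2 * normc (trig_of_vec v t) ^+ 2 +
                                normc (trig_of_vec w t) ^+ 2)).
  have -> : sqnorm w = torus_mean (fun t => complex.Re (F t))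
    by have := congr1 (@complex.Re R) key.
  apply: torus_mean_le.
  - by case: hF.
  - apply: bborelM; first exact: bborel_cst.
    apply: bborelD; last exact: cborel_norm2.
    by apply: bborelM; [exact: bborel_cst|exact: cborel_norm2].
  move=> t tt; apply: le_trans (ler_norm _) _;
    apply: le_trans (normc_ge_absRe _) _.
  rewrite /F !ComplexField.Normc.normcM.
  have ncj (z : C) : normc (cj z) = normc z by case: z => a b; rewrite /= sqrrN.
  rewrite !ncj; have := gB _ tt; have := normc_ge0 (g t).
  set a := normc (g t); set b := normc _; set c := normc _.
  have : 0 <= b by exact: normc_ge0.
  have : 0 <= c by exact: normc_ge0.
  move=> c0 b0 a0 aB; have := sqr_ge0 (B * b - c).
  have : a * (b * c) <= B * (b * c) by rewrite ler_wpM2r ?mulr_ge0.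
  nra.
rewrite torus_meanZ ?torus_meanD ?torus_meanZ ?parseval; last 4 first.
- exact: cborel_norm2.
- by apply: bborelM; [exact: bborel_cst|exact: cborel_norm2].
- exact: cborel_norm2.
- apply: bborelD; last exact: cborel_norm2.
  by apply: bborelM; [exact: bborel_cst|exact: cborel_norm2].
lra.
Qed.

End ToeplitzNorm.

(** * Circulant matrices and trigonometric polynomials *)

Section Circulant.
Context {R : realType}.
Local Notation C := R[i].
Local Notation cj := (@conjc R).

Lemma sum_divmod (V : nmodType) (F : nat -> nat -> V) m n : (0 < n)%N ->
  \sum_(k < m * n) F (k %/ n)%N (k %% n)%N = \sum_(i < m) \sum_(j < n) F i j.
Proof.
move=> n0; elim: m => [|m IH]; first by rewrite !big_ord0.
rewrite big_ord_recr /= -IH.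
rewrite -(big_mkord xpredT (fun k => F (k %/ n)%N (k %% n)%N)).
rewrite (big_cat_nat _ (n := m * n)) //=; last by rewrite leq_mul2r leqnSn orbT.
rewrite big_mkord; congr (_ + _).
rewrite -{1}[(m * n)%N]add0n big_addn mulSn addnK big_mkord.
by apply: eq_bigr => j _;
  rewrite addnC divnMDl// modnMDl divn_small// addn0 modn_small.
Qed.

Definition frequency n (k : 'I_(n * n)) : R * R :=
  ((k %/ n)%:R * (2 * pi / n%:R), (k %% n)%:R * (2 * pi / n%:R)).

Definition grid_mean n (f : R * R -> C) : C :=
  (n * n)%:R^-1 * \sum_(k < n * n) f (frequency k).

Lemma expi_int_2pi (m : int) : expi (m%:~R * (2 * pi)) = 1 :> C.
Proof.
have h1 : expi (2 * pi) = 1 :> C.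
  by rewrite /expi mulr_natl cos2pi -[X in sin X]mulr_natl (sin_int_pi 2).
case: m => n; first by rewrite expi_expn h1 expr1n.
by rewrite NegzE mulrNz mulNr expiN expi_expn h1 expr1n conjc1.
Qed.

Lemma expi_neq1 (x : R) : 0 < `|x| < 2 * pi -> expi x != 1 :> C.
Proof.
move=> /andP[x0 x2]; apply/negP => /eqP /(congr1 (@complex.Re R)) /= h.
have s0 : sin (`|x| / 2) > 0.
  by apply: sin_gt0_pi; rewrite divr_gt0//= ltr_pdivrMr// mulrC.
move: h; have -> : cos x = cos (`|x| / 2 + `|x| / 2).
  rewrite -splitr; have [_|_] := ler0P x; rewrite ?cosN//.
rewrite cosD -!expr2 cos2sin2; have := exprn_gt0 2 s0; lra.
Qed.

(** Sum of the n-th roots of unity; the bound on m excludes the nonzero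
    multiples of n. *)
Lemma geometric_expi n (m : int) : (0 < n)%N -> (`|m| < n)%N ->
  \sum_(j < n) expi (m%:~R * (j%:R * (2 * pi / n%:R))) =
    (n * (m == 0%R))%:R :> C.
Proof.
move=> n0 mn; have n0' : n%:R != 0 :> R by rewrite pnatr_eq0 -lt0n.
have E (j : nat) : expi (m%:~R * (j%:R * (2 * pi / n%:R))) =
    expi (m%:~R * (2 * pi / n%:R)) ^+ j :> C.
  by rewrite -expi_expn; congr expi; ring.
under eq_bigr => j _ do rewrite E.
have [->|m0] := eqVneq m 0.
  by rewrite mul0r expi0 muln1; under eq_bigr => j _ do rewrite expr1n;
    rewrite sumr_const card_ord.
rewrite muln0; apply/eqP.
have := subrX1 (expi (m%:~R * (2 * pi / n%:R)) : C) n.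
rewrite -expi_expn (_ : n%:R * _ = m%:~R * (2 * pi)); last by field.
rewrite expi_int_2pi subrr => /esym/eqP; rewrite mulf_eq0 => /orP[|//].
rewrite subr_eq0 => h; exfalso; move: h; apply/negP/expi_neq1.
have pi0 := pi_gt0 R; have nR : 0 < n%:R :> R by rewrite ltr0n.
have c0 : 0 < 2 * pi / n%:R :> R by rewrite divr_gt0 ?mulr_gt0.
rewrite normrM (gtr0_norm c0) mulr_gt0 ?normr_gt0 ?intr_eq0//=.
rewrite mulrCA -[ltRHS]mulr1 mulrA -mulrA ltr_pM2l ?mulr_gt0//.
by rewrite ltr_pdivrMr// mul1r -intr_norm -[n%:R]/(n%:Z%:~R) ltr_int -abszE
  ltz_nat.
Qed.

Definition small_mode n (m : int * int) : bool :=
  (`|m.1| < n)%N && (`|m.2| < n)%N.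

(** Discrete orthogonality, free of aliasing for modes smaller than the
    grid. *)
Lemma grid_mean_emode n m : (0 < n)%N -> small_mode n m ->
  grid_mean n (emode m) = (m == 0)%:R.
Proof.
move=> n0 /andP[m1 m2]; rewrite /grid_mean /emode.
rewrite (sum_divmod (fun i j => expi (m.1%:~R * (i%:R * (2 * pi / n%:R)) +
  m.2%:~R * (j%:R * (2 * pi / n%:R))))) //.
under eq_bigr => i _.
  under eq_bigr => j _ do rewrite expiD.
  rewrite -mulr_sumr geometric_expi//.
  over.
rewrite -mulr_suml geometric_expi// -natrM.
have -> : (m == 0) = (m.1 == 0) && (m.2 == 0) by case: m {m1 m2}.
have nn : (n * n)%:R != 0 :> C by rewrite pnatr_eq0 muln_eq0 orbb -lt0n.
case: (m.1 == 0); case: (m.2 == 0); rewrite ?muln1 ?muln0 ?mul0n ?mulr0 //=.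
by rewrite mulVf.
Qed.

Definition dft n : 'M[C]_(n * n) :=
  \matrix_(k, r) (n%:R^-1 * emode (grid_index r) (frequency k)).

Lemma small_grid_index n (r s : 'I_(n * n)) :
  small_mode n (grid_index s - grid_index r).
Proof.
have [r1 r2] := idx_lt r; have [s1 s2] := idx_lt s.
rewrite /small_mode /grid_index /= /idx1 /idx2; move: r1 r2 s1 s2.
set a := (r %/ n)%N; set b := (r %% n)%N; set c := (s %/ n)%N;
  set d := (s %% n)%N.
by move=> *; lia.
Qed.

Definition circulant n (f : R * R -> C) : 'M[C]_(n * n) :=
  (dft n)^t* *m diag_mx (\row_k f (frequency k)) *m dft n.

(** The entries are discrete Fourier coefficients of f, as those of the
    Toeplitz matrix are continuous ones (compare [toeplitzE]). *)
Lemma circulantE n f r s : circulant n f r s =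
  grid_mean n (fun t => f t * emode (grid_index s - grid_index r) t).
Proof.
rewrite /circulant mul_mx_diag mxE /grid_mean mulr_sumr; apply: eq_bigr => k _.
rewrite !mxE emodeD emodeN natrM invfM.
have -> : ((n%:R^-1 * emode (grid_index r) (frequency k))^* =
  n%:R^-1 * cj (emode (grid_index r) (frequency k)) :> C)%R.
  by rewrite rmorphM /= fmorphV /= rmorph_nat.
ring.
Qed.

(** The columns are orthonormal by [circulantE] applied to f = 1. *)
Lemma dft_unitary n : dft n \is unitarymx.
Proof.
rewrite -trmxC_unitary; apply/unitarymxP; rewrite trmxCK.
apply/matrixP => r s; have [n0|n0] := posnP n; first by case: n r s n0 => [[]|].
have := circulantE (fun=> 1) r s; rewrite /circulant.
have -> : diag_mx (\row_(k < n * n) (1 : C)) = 1%:M.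
  by apply/matrixP => i j; rewrite !mxE; case: (i == j).
rewrite mulmx1 => ->; under [X in grid_mean _ X]eq_fun do rewrite mul1r.
rewrite grid_mean_emode ?small_grid_index// mxE; congr ((_ : bool)%:R).
by rewrite subr_eq0 (inj_eq (@grid_index_inj n)) eq_sym.
Qed.

Lemma circulant_singular_values n (f : R * R -> C) :
  has_singular_values (circulant n f) (fun k => normc (f (frequency k))).
Proof.
split; first by move=> k; exact: normc_ge0.
exists (dft n); first exact: dft_unitary.
set U := dft n; have UU : U *m U^t* = 1%:M by apply/unitarymxP/dft_unitary.
rewrite /circulant -/U !trmx_mul !map_mxM /= trmxCK !mulmxA.
rewrite -(mulmxA _ U) UU mulmx1 -(mulmxA _ _ (diag_mx _)); congr (_ *m _ *m _).
rewrite tr_diag_mx map_diag_mx mulmx_diag; congr diag_mx.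
by apply/rowP => k; rewrite !mxE sqr_normcE mulrC.
Qed.

(** A list of frequencies and coefficients, where a frequency may be repeated:
    sums and products need no collection of terms, which is done only once, in
    [fourier_sum_trig_poly]. *)
Definition fourier_sum (L : seq ((int * int) * C)) (t : R * R) : C :=
  \sum_(x <- L) x.2 * emode x.1 t.

Definition fourier_degree (L : seq ((int * int) * C)) : nat :=
  \max_(x <- L) maxn `|x.1.1| `|x.1.2|.

Lemma cborel_fourier_sum L : cborel (fourier_sum L).
Proof.
by apply: cborel_sum => x; apply: cborelM; [exact: cborel_cst|exact: cborel_emode].
Qed.

Lemma fourier_sum_trig_poly L : trig_poly (fourier_sum L).
Proof.
exists (undup (map fst L)), (fun k => \sum_(x <- L | x.1 == k) x.2) => t.
rewrite /fourier_sum;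
  under [RHS]eq_bigr => k _ do rewrite mulr_suml big_mkcond /=.
rewrite exchange_big /= [LHS]big_seq [RHS]big_seq; apply: eq_bigr => x xL.
rewrite (bigD1_seq x.1) ?undup_uniq ?mem_undup ?map_f//= eqxx big1 ?addr0//.
by move=> k kx; rewrite eq_sym (negbTE kx).
Qed.

(** Both means extract the constant coefficient: equispaced quadrature is exact
    for trigonometric polynomials of degree less than the number of nodes. *)
Lemma grid_mean_fourier_sum n L : (fourier_degree L < n)%N ->
  grid_mean n (fourier_sum L) = torus_cmean (fourier_sum L).
Proof.
move=> dn; have n0 : (0 < n)%N by exact: leq_ltn_trans dn.
rewrite /fourier_sum torus_cmean_sum; last first.
  by move=> x; apply: cborelM; [exact: cborel_cst|exact: cborel_emode].
rewrite /grid_mean exchange_big /= mulr_sumr big_seq [RHS]big_seq.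
apply: eq_bigr => x xL; rewrite torus_cmeanZ ?torus_cmean_emode;
  last exact: cborel_emode.
rewrite -mulr_sumr mulrCA -/(grid_mean n (emode x.1)) grid_mean_emode//.
have : (maxn `|x.1.1| `|x.1.2| <= fourier_degree L)%N by exact: leq_bigmax_seq.
by rewrite geq_max => /andP[h1 h2]; rewrite /small_mode !(leq_ltn_trans _ dn).
Qed.

(** The positions that a shift by at most D in some direction may move out of
    the square of indices. *)
Definition boundary n D : {set 'I_(n * n)} :=
  [set r : 'I_(n * n) | [|| (r %/ n < D)%N, (n - D <= r %/ n)%N,
                         (r %% n < D)%N | (n - D <= r %% n)%N]].

Lemma card_boundary n D : (#|boundary n D| <= 4 * D * n)%N.
Proof.
have [n0|n0] := posnP n.
  by rewrite (leq_trans (max_card _)) // card_ord n0.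
pose b (i : nat) : nat := ((i < D) + (n - D <= i))%N.
have hb : (\sum_(i < n) b i <= 2 * D)%N.
  rewrite /b big_split /= mul2n -addnn leq_add//.
    rewrite -(big_mkord xpredT (fun i => nat_of_bool (i < D)%N)).
    have -> : (\sum_(0 <= i < n) (i < D) = minn n D)%N.
      elim: n {b n0} => [|n IH]; first by rewrite big_geq// min0n.
      by rewrite big_nat_recr //= IH; lia.
    exact: geq_minr.
  rewrite -(big_mkord xpredT (fun i => nat_of_bool (n - D <= i)%N)).
  have h m : (\sum_(0 <= i < m) (n - D <= i) = m - (n - D))%N.
    elim: m => [|m IH]; first by rewrite big_geq.
    by rewrite big_nat_recr //= IH; lia.
  by rewrite h; lia.
apply: (@leq_trans (\sum_(k < n * n) (b (k %/ n) + b (k %% n)))%N).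
  rewrite -sum1_card big_mkcond /=; apply: leq_sum => k _.
  rewrite inE /b; case: (k %/ n < D)%N; case: (n - D <= k %/ n)%N;
    by case: (k %% n < D)%N; case: (n - D <= k %% n)%N.
rewrite (sum_divmod (fun i j => (b i + b j)%N)) //.
under eq_bigr => i _ do rewrite big_split /= sum_nat_const card_ord.
rewrite big_split /= sum_nat_const card_ord -big_distrr /=.
apply: (@leq_trans (n * (2 * D) + n * (2 * D))%N); last by nia.
by apply: leq_add; rewrite leq_mul2l; apply/orP; right; exact: hb.
Qed.

(** In a row away from the boundary, the shifts by frequencies of the
    polynomial do not wrap around, so continuous and discrete Fourier
    coefficients agree there. *)
Lemma toeplitz_circulant_rank n L :
  (\rank (toeplitz n (fourier_sum L) - circulant n (fourier_sum L))%R <=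
    4 * fourier_degree L * n)%N.
Proof.
apply: leq_trans (card_boundary n (fourier_degree L));
  apply: rank_few_rows => r s rB.
have n0 : (0 < n)%N by case: n r s rB => [[]|].
rewrite [LHS]mxE [X in _ + X]mxE toeplitzE circulantE; apply/eqP;
  rewrite subr_eq0; apply/eqP.
have E : (fun t => fourier_sum L t * emode (grid_index s - grid_index r) t) =
    (fun t => \sum_(x <- L) x.2 * emode (x.1 +
      (grid_index s - grid_index r)) t).
  apply/funext => t; rewrite /fourier_sum mulr_suml; apply: eq_bigr => x _.
  by rewrite (emodeD x.1) mulrA.
rewrite !E torus_cmean_sum; last first.
  by move=> x; apply: cborelM; [exact: cborel_cst|exact: cborel_emode].
rewrite /grid_mean exchange_big /= mulr_sumr big_seq [RHS]big_seq.
apply: eq_bigr => x xL; rewrite torus_cmeanZ ?torus_cmean_emode;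
  last exact: cborel_emode.
rewrite -mulr_sumr mulrCA -/(grid_mean n (emode _)) grid_mean_emode//.
have /[!geq_max]/andP[x1 x2] : (maxn `|x.1.1| `|x.1.2| <= fourier_degree L)%N
  by exact: leq_bigmax_seq.
have [s1 s2] := idx_lt s.
move: rB; rewrite inE !negb_or -!ltnNge => /and4P[].
case: x {xL} x1 x2 => [[u v] z] /= x1 x2; move: s1 s2 x1 x2;
  move: (fourier_degree L) => D.
rewrite /small_mode /grid_index /= /idx1 /idx2.
set a := (r %/ n)%N; set b := (r %% n)%N; set c := (s %/ n)%N;
  set d := (s %% n)%N.
by move=> *; lia.
Qed.

Definition tau (t : R * R) : R :=
  4 * sin (t.1 / 2) ^+ 2 + 4 * sin (t.2 / 2) ^+ 2.

Lemma tau_bound t : 0 <= tau t <= 8.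
Proof.
have s (x : R) : 0 <= sin x ^+ 2 <= 1.
  by rewrite sqr_ge0 /= sin2cos2 gerBl sqr_ge0.
by have := s (t.1 / 2); have := s (t.2 / 2); rewrite /tau; lra.
Qed.

Lemma tau_fourier_sum : exists L, forall t, (tau t)%:C = fourier_sum L t.
Proof.
exists [:: ((0, 0), 4%:R); ((1, 0), -1); ((-1, 0), -1); ((0, 1), -1);
  ((0, -1), -1)] => t.
have hs x : 4 * sin (x / 2) ^+ 2 = 2 - 2 * cos x :> R.
  rewrite {2}[x]splitr cosD -!expr2 cos2sin2; ring.
have e0 : emode ((0, 0) : int * int) t = 1 by exact: emode0.
have e1 : emode ((1, 0) : int * int) t = expi t.1.
  by rewrite /emode /= mul1r mul0r addr0.
have e2 : emode ((-1, 0) : int * int) t = expi (- t.1).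
  by rewrite /emode /= mulN1r mul0r addr0.
have e3 : emode ((0, 1) : int * int) t = expi t.2.
  by rewrite /emode /= mul1r mul0r add0r.
have e4 : emode ((0, -1) : int * int) t = expi (- t.2).
  by rewrite /emode /= mulN1r mul0r add0r.
rewrite /fourier_sum !big_cons big_nil /tau !hs e0 e1 e2 e3 e4 !expiN mulr1
  addr0.
by apply: complex_ext; rewrite !(cReD, cImD, cReM, cImM) /=; ring.
Qed.

Lemma fourier_sumM L1 L2 t : fourier_sum L1 t * fourier_sum L2 t =
  fourier_sum [seq (x.1 + y.1, x.2 * y.2) | x <- L1, y <- L2] t.
Proof.
rewrite /fourier_sum big_allpairs_dep mulr_suml; apply: eq_bigr => x _.
by rewrite mulr_sumr; apply: eq_bigr => y _ /=; rewrite emodeD; ring.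
Qed.

Lemma poly_tau_fourier_sum (p : {poly R}) : exists L, forall t,
  (p.[tau t])%:C = fourier_sum L t.
Proof.
have [L0 h0] := tau_fourier_sum.
elim/poly_ind: p => [|p c [L h]].
  by exists [::] => t; rewrite /fourier_sum big_nil horner0.
exists (((0, 0), c%:C) :: [seq (x.1 + y.1, x.2 * y.2) | x <- L, y <- L0]) => t.
rewrite /fourier_sum big_cons -/(fourier_sum _ t) -fourier_sumM -h -h0 emode0
  !hornerE.
by rewrite rmorphD rmorphM addrC.
Qed.

End Circulant.

(** * Asymptotics of the discretization matrices *)

Section Discretization.
Context {R : realType}.
Local Notation C := R[i].
Local Notation T2 := (measurableTypeR R * measurableTypeR R)%type.

Lemma operator_boundD d (N1 N2 : 'M[C]_d) (w1 w2 : R) :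
  (forall v : 'rV[C]_d, vnorm (v *m N1^t*) <= w1%:C * vnorm v) ->
  (forall v : 'rV[C]_d, vnorm (v *m N2^t*) <= w2%:C * vnorm v) ->
  forall v : 'rV[C]_d, vnorm (v *m (N1 + N2)^t*) <= (w1 + w2)%:C * vnorm v.
Proof.
move=> h1 h2 v; have -> : (N1 + N2)^t* = N1^t* + N2^t*
  by rewrite linearD /= map_mxD.
rewrite mulmxDr rmorphD /= mulrDl.
exact: le_trans (vnormD _ _) (lerD (h1 v) (h2 v)).
Qed.

Lemma diag_operator_bound d (D : 'rV[C]_d) (B : R) : 0 <= B ->
  (forall i, normc (D 0 i) <= B) ->
  forall v : 'rV[C]_d, vnorm (v *m (diag_mx D)^t*) <= B%:C * vnorm v.
Proof.
move=> B0 hD v; apply: vnorm_le => //; rewrite /sqnorm mulr_sumr.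
apply: ler_sum => i _.
rewrite tr_diag_mx map_diag_mx mul_mx_diag mxE [X in _ * X]mxE.
have ncj (z : C) : normc (Num.conj z) = normc z by case: z => a b;
  rewrite /= sqrrN.
rewrite ComplexField.Normc.normcM ncj exprMn mulrC ler_wpM2r ?sqr_ge0//.
by rewrite ler_pXn2r ?nnegrE ?normc_ge0.
Qed.

Lemma rank_diag_support d (D : 'rV[C]_d) (S : {set 'I_d}) :
  (forall i, i \notin S -> D 0 i = 0) -> (\rank (diag_mx D) <= #|S|)%N.
Proof.
move=> h; apply: rank_few_rows => i j iS.
by rewrite !mxE h // mul0rn.
Qed.

Variables (alpha : R).
Hypothesis halpha : 1 < alpha < 2.

(** The absolute value only serves to have a function that is continuous on the
    whole line; the arguments of interest lie in [0, 8]. *)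
Definition half_power (x : R) : R := `|x| `^ (alpha / 2).

Let a_gt0 : 0 < alpha / 2.
Proof. by case/andP: halpha => h _; rewrite divr_gt0// (lt_trans ltr01). Qed.

Lemma continuous_half_power : continuous half_power.
Proof.
move=> x; have [->|x0] := eqVneq x 0.
  apply/cvgrPdist_lt => e e0; rewrite /half_power normr0 powR0 ?gt_eqF//.
  near=> y; rewrite sub0r normrN ger0_norm ?powR_ge0//.
  have -> : e = (e `^ (alpha / 2)^-1) `^ (alpha / 2).
    by rewrite -powRrM mulVf ?powRr1 ?(ltW e0)// gt_eqF.
  apply: gt0_ltr_powR => //; rewrite ?nnegrE ?powR_ge0//.
  near: y; have := @nbhs0_lt _ R (e `^ (alpha / 2)^-1).
  by apply; exact: powR_gt0.
have cn : {for `|x|, continuous (fun y : R => y `^ (alpha / 2))}.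
  apply: differentiable_continuous; apply/derivable1_diffP.
  by have [] := @is_derive1_powR _ (alpha / 2) `|x| (_ : 0 < `|x|);
    rewrite ?normr_gt0.
exact: (continuous_comp (@norm_continuous _ R x) cn).
Unshelve. all: by end_near. Qed.

Lemma t_half_power t : t_ alpha t = (half_power (tau t))%:C.
Proof.
by rewrite /t_ /half_power ger0_norm//; have /andP[] := tau_bound t.
Qed.

Lemma bborel_tau : bborel (tau : T2 -> R).
Proof.
have [L h] := @tau_fourier_sum R; have [hr _] := cborel_fourier_sum L.
by move: hr; under eq_fun do rewrite -h.
Qed.

Lemma bborel_poly_tau (p : {poly R}) : bborel (fun t : T2 => p.[tau t]).
Proof.
have [L h] := poly_tau_fourier_sum p; have [hr _] := cborel_fourier_sum L.
by move: hr; under eq_fun do rewrite -h.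
Qed.

(** G (tau t) is within distance 1 of a trigonometric polynomial, which bounds
    it. *)
Lemma bborel_comp_tau (G : R -> R) : continuous G ->
  bborel (fun t : T2 => G (tau t)).
Proof.
move=> cG; split.
  by apply: measurableT_comp;
    [exact: continuous_measurable_fun|case: bborel_tau].
have [p hp] := weierstrass cG (ltr0n R 8) ltr01.
have [_ [B hB]] := bborel_poly_tau p.
exists (1 + B) => t; have -> : G (tau t) = (G (tau t) - p.[tau t]) + p.[tau t]
  by ring.
exact: le_trans (ler_normD _ _) (lerD (hp _ (tau_bound t)) (hB t)).
Qed.

Lemma cborel_real (f : T2 -> R) : bborel f -> cborel (fun t => (f t)%:C).
Proof. by move=> hf; split=> //=; exact: bborel_cst. Qed.

Lemma toeplitzB n (f g : R * R -> C) : cborel f -> cborel g ->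
  toeplitz n (fun t => f t - g t) = toeplitz n f - toeplitz n g.
Proof.
move=> hf hg; apply/matrixP => r s; rewrite [RHS]mxE [X in _ + X]mxE !toeplitzE.
rewrite -[- torus_cmean _]mulN1r -torus_cmeanZ; last by apply: cborelM => //;
  exact: cborel_emode.
rewrite -torus_cmeanD; last 2 first.
- by apply: cborelM => //; exact: cborel_emode.
- by apply: cborelM; [exact: cborel_cst|apply: cborelM => //;
    exact: cborel_emode].
by congr torus_cmean; apply/funext => t; ring.
Qed.

Variable mu : R * R -> C.
Hypothesis hriemann : forall M : R, 0 < M ->
  riemann_integrable_square (trunc_fun M mu).

Definition fde_matrix n : 'M[C]_(n * n) :=
  toeplitz n (t_ alpha) + (hstep n `^ alpha)%:C *: diag_h n mu.

(** The samples of mu above the level M of [few_large_values] go into the low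
    rank part. The others are multiplied by h^alpha <= h <= eps / M and join the
    Toeplitz matrix of t_alpha - p(tau) in the part of small norm. *)
Lemma fde_decomposition (p : {poly R}) L (eps : R) : 0 < eps ->
  (forall t, (p.[tau t])%:C = fourier_sum L t) ->
  (forall x, 0 <= x <= 8 -> `|half_power x - p.[x]| <= eps) ->
  exists n0, forall n, (n0 <= n)%N -> exists Rm N : 'M[C]_(n * n),
    [/\ fde_matrix n = toeplitz n (fourier_sum L) + Rm + N,
        (\rank Rm)%:R <= eps * (n * n)%:R &
        forall v : 'rV[C]_(n * n), vnorm (v *m N^t*) <= (2 * eps)%:C * vnorm v].
Proof.
move=> e0 pL hp; have [M M0 [n1 hn1]] := few_large_values hriemann e0.
exists (maxn n1 (Num.truncn (M / eps))) => n; rewrite geq_max => /andP[n1n nM].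
pose c : C := (hstep n `^ alpha)%:C.
pose lg (k : 'I_(n * n)) := M < normc (mu (grid_point k)).
pose D1 : 'rV[C]_(n * n) := \row_k if lg k then c * mu (grid_point k) else 0.
pose D2 : 'rV[C]_(n * n) := \row_k if lg k then 0 else c * mu (grid_point k).
exists (diag_mx D1),
  (toeplitz n (fun t => t_ alpha t - fourier_sum L t) + diag_mx D2).
have ct : cborel (t_ alpha : T2 -> C).
  have := cborel_real (bborel_comp_tau continuous_half_power).
  by under eq_fun do rewrite -t_half_power.
have cL := cborel_fourier_sum L.
split.
- rewrite /fde_matrix toeplitzB// -/c.
  have -> : c *: diag_h n mu = diag_mx D1 + diag_mx D2.
    rewrite /diag_h -linearZ -linearD /=; congr diag_mx; apply/rowP => k.
    by rewrite !mxE; case: (lg k); rewrite ?addr0 ?add0r.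
  by rewrite [RHS]addrACA (addrC (toeplitz n (fourier_sum L))) subrK.
- apply: le_trans (hn1 _ n1n); rewrite ler_nat; apply: rank_diag_support => k.
  by rewrite inE /D1 mxE => /negbTE; rewrite /lg => ->.
- have -> : 2 * eps = eps + eps by ring.
  apply: operator_boundD.
    apply: toeplitz_norm; rewrite ?(ltW e0)//.
      have -> : (fun t => t_ alpha t - fourier_sum L t) =
        (fun t => t_ alpha t + (-1) * fourier_sum L t).
        by apply/funext => t; rewrite mulN1r.
      by apply: cborelD => //; apply: cborelM => //; exact: cborel_cst.
    by move=> t _; rewrite t_half_power -pL -rmorphB normc_real hp// tau_bound.
  apply: diag_operator_bound; first exact: ltW.
  move=> k; rewrite mxE; case: ifPn => [_|];
    first by rewrite normc_real normr0 ltW.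
  rewrite -leNgt => kM;
    rewrite ComplexField.Normc.normcM normc_real ger0_norm ?powR_ge0//.
  apply: (@le_trans _ _ (hstep n * M)).
    rewrite ler_pM ?powR_ge0 ?normc_ge0//; apply: ge1r_powR.
      by rewrite hstep_gt0 /= /hstep invf_le1 ?ltr0n// ler1n.
    by case/andP: halpha => /ltW.
  rewrite /hstep ler_pdivrMl ?ltr0n// mulrC -ler_pdivrMl// mulrC.
  apply: ltW; apply: lt_le_trans (truncnS_gt _) _.
  by rewrite ler_nat ltnS.
Qed.

Lemma Ck_cst k (c : R) : Ck k (fun=> c : R).
Proof.
elim: k c => [|k IH] c /=; split=> //; try exact: cst_continuous.
have D0 v : (fun x : R * R => 'D_v (fun=> c) x) = (fun=> 0 : R).
  by apply/funext => x; exact: derive_cst.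
by split; rewrite ?D0 // => x; exact: derivable_cst.
Qed.

Lemma half_power_fourier_approx (eps : R) : 0 < eps ->
  exists pL : {poly R} * seq ((int * int) * C),
  (forall t, (pL.1.[tau t])%:C = fourier_sum pL.2 t) /\
  (forall x, 0 <= x <= 8 -> `|half_power x - pL.1.[x]| <= eps).
Proof.
move=> e0; have [p hp] := weierstrass continuous_half_power (ltr0n R 8) e0.
by have [L hL] := poly_tau_fourier_sum p; exists (p, L).
Qed.

Lemma inv_succ_cvg0 : (fun m : nat => m.+1%:R^-1 : R) @ \oo --> (0 : R).
Proof. exact: cvg_harmonic. Qed.

(** The symbols p_m(tau) converge uniformly to t_alpha, so the exceptional sets
    in the convergence in measure are eventually empty. *)
Lemma fde_GLT : GLT fde_matrix (fun z => t_ alpha z.2).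
Proof.
split.
  have h : measurable_fun [set: T2] (fun t => complex.Re (t_ alpha t : C)).
    under eq_fun do rewrite t_half_power /=.
    by case: (bborel_comp_tau continuous_half_power).
  split; apply: measurable_funTS; last exact: measurable_cst.
  exact: (measurableT_comp h measurable_snd).
have e_gt0 (m : nat) : 0 < m.+1%:R^-1 :> R by rewrite invr_gt0.
have [pL hpL] := choice (fun m : nat => half_power_fourier_approx (e_gt0 m)).
exists (fun=> 1%N), (fun _ _ => fun=> 1), (fun m _ => fourier_sum (pL m).2);
  split.
- move=> m i _; split; last exact: fourier_sum_trig_poly.
  exists (fun=> 1), (fun=> 0); split; last by [].
  by move=> k; split; exact: Ck_cst.
- move=> e e0; apply: cvg_near_cst; near=> m.
  rewrite [X in _ X = _](_ : _ = set0) ?measure0// -subset0 => z [_] /=;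
    rewrite big_ord1 mul1r.
  have [hL hp] := hpL m.
  rewrite -hL t_half_power -rmorphB normc_real distrC ltNge => /negP; apply.
  apply: le_trans (hp _ (tau_bound _)) _; near: m.
  have := inv_succ_cvg0; move=> /cvgrPdist_lt /(_ _ e0).
  by apply: filterS => m;
    rewrite sub0r normrN ger0_norm ?(ltW (e_gt0 m))// => /ltW.
exists (fun m => m.+1%:R^-1), (fun m => 2 * m.+1%:R^-1); split.
- exact: inv_succ_cvg0.
- by rewrite -[0](mulr0 2); apply: cvgM; [exact: cvg_cst|exact: inv_succ_cvg0].
move=> m; have [hL hp] := hpL m.
have [n0 h] := fde_decomposition (e_gt0 m) hL hp.
exists n0 => n nn; have [Rm [N [E rR hN]]] := h n nn.
exists Rm, N; split => //; last first.
  by apply: spectral_norm_le => //; rewrite mulr_ge0 ?(ltW (e_gt0 m)).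
rewrite big_ord1; have -> : diag_n n (fun=> 1 : C) = 1%:M.
  by apply/matrixP => i j; rewrite !mxE; case: (i == j).
by rewrite mul1mx.
Unshelve. all: by end_near. Qed.

Lemma card_count_above d (a : 'I_d -> R) (t : R) :
  #|[set i | t < a i]%SET|%:R = count_above a t.
Proof.
rewrite /count_above -sum1_card natr_sum big_mkcond /=.
by apply: eq_bigr => i _; rewrite inE; case: (t < a i).
Qed.

Lemma natVC (m : nat) : (m%:R^-1 : R)%:C = m%:R^-1 :> C.
Proof. by rewrite (fmorphV (real_complex R)) (rmorph_nat (real_complex R)). Qed.

(** The comparison of means of the real part or of the imaginary part of the
    test function. The error e is spent in four equal parts: from A_n to the
    circulant matrix, from p to the half power inside G, from G to q on the
    grid, and back from q to G on the torus. *)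
Lemma fde_mean_singular_values (G : R -> R) (L e : R) : continuous G ->
  (forall x, L <= x -> G x = 0) -> 0 < e ->
  exists n0, forall n, (n0 <= n)%N ->
    `|torus_mean (fun t => G (half_power (tau t))) -
      (n * n)%:R^-1 * \sum_(i < n * n) G (sing_val (fde_matrix n) i)| <= e.
Proof.
move=> cG GL e0; have e4 : 0 < e / 4 by rewrite divr_gt0.
have [dl dl0 [rho rho0 hcount]] := count_close cG GL e4.
pose B : R := 8 `^ (alpha / 2).
have [d2 d20 hd2] := uniform_continuity_segment 0 B cG e4.
(* 2 eta bounds the norm of N, and eta the relative rank of Rm and the change
   that the error of p causes in the argument of G. *)
pose eta := Num.min (Num.min (dl / 2) (rho / 2)) (d2 / 2).
have eta0 : 0 < eta by rewrite !lt_min !divr_gt0.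
have eta_dl : 2 * eta <= dl.
  by rewrite mulrC -ler_pdivlMr// /eta !ge_min lexx.
have eta_rho : eta <= rho / 2 by rewrite /eta !ge_min lexx orbT.
have eta_d2 : eta < d2.
  apply: (@le_lt_trans _ _ (d2 / 2)); first by rewrite /eta !ge_min lexx orbT.
  by rewrite ltr_pdivrMr// ltr_pMr// ltr1n.
have [[p Lp] /= [pL hp]] := half_power_fourier_approx eta0.
have [n1 hn1] := fde_decomposition eta0 pL hp.
have cH : continuous (fun x => G (half_power x)).
  by move=> x; exact: (continuous_comp (@continuous_half_power x) (cG _)).
have [q hq] := weierstrass cH (ltr0n R 8) e4.
have [Lq qL] := poly_tau_fourier_sum q.
(* From n2 on, the boundary rows make up at most half of the allowed rank. *)
pose n2 := (Num.truncn (8 * (fourier_degree Lp)%:R / rho)).+1.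
exists (maxn (maxn n1 n2) (fourier_degree Lq).+1) => n.
rewrite !geq_max => /andP[/andP[n1n n2n] nq].
have n_gt0 : (0 < n)%N by exact: leq_trans nq.
have nn0 : 0 < (n * n)%:R :> R by rewrite ltr0n muln_gt0 n_gt0.
have [Rm [N [E rR hN]]] := hn1 n n1n.
pose a (k : 'I_(n * n)) := normc (fourier_sum Lp (frequency k)).
have aE k : a k = `|p.[tau (frequency k)]| by rewrite /a -pL normc_real.
have a_sv : has_singular_values (circulant n (fourier_sum Lp)) a
  by exact: circulant_singular_values.
have b_sv := sing_val_has_singular_values (fde_matrix n).
set b := sing_val _ in b_sv *.
pose Q := toeplitz n (fourier_sum Lp) - circulant n (fourier_sum Lp) + Rm.
have E1 : fde_matrix n = circulant n (fourier_sum Lp) + Q + N.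
  by rewrite E /Q !addrA (addrC (circulant n (fourier_sum Lp))) addrK.
have E2 : circulant n (fourier_sum Lp) = fde_matrix n + (- Q) + (- N).
  by rewrite E1 addrAC addrK addrK.
have hN' (v : 'rV[C]_(n * n)) : vnorm (v *m (- N)^t*) <= (2 * eta)%:C * vnorm v.
  have -> : (- N)^t* = - N^t* by rewrite linearN /= map_mxN.
  rewrite mulmxN; have -> : vnorm (- (v *m N^t*)) = vnorm (v *m N^t*).
    by rewrite /vnorm hnormN.
  exact: hN.
have w0 : 0 <= 2 * eta by rewrite mulr_ge0 ?(ltW eta0).
have rQ : (\rank Q)%:R <= rho * (n * n)%:R.
  apply: (@le_trans _ _ ((4 * fourier_degree Lp * n)%:R + eta * (n * n)%:R)).
    apply: (@le_trans _ _ ((4 * fourier_degree Lp * n)%:R + (\rank Rm)%:R));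
      last by rewrite lerD2l.
    rewrite -natrD ler_nat; apply: leq_trans (mxrank_add _ _) _.
    by rewrite leq_add2r toeplitz_circulant_rank.
  have h : (4 * fourier_degree Lp * n)%:R <= rho / 2 * (n * n)%:R.
    rewrite !natrM mulrA ler_pM2r ?ltr0n//.
    have : 8 * (fourier_degree Lp)%:R / rho <= n%:R.
      by apply: ltW; apply: lt_le_trans (truncnS_gt _) _; rewrite ler_nat.
    by rewrite ler_pdivrMr//; lra.
  have := ler_wpM2r (ltW nn0) eta_rho; move: h; set z := (n * n)%:R; lra.
have close := hcount _ a b (2 * eta) (\rank Q)%:R (proj1 a_sv) (proj1 b_sv).
have {}close : `|\sum_i G (a i) - \sum_i G (b i)| <= e / 4 * (n * n)%:R.
  apply: close => //.
  - by rewrite w0.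
  - move=> t; rewrite -!card_count_above -natrD ler_nat.
    exact: (weyl_counting t a_sv b_sv E1 w0 hN).
  - move=> t; rewrite -!card_count_above -natrD ler_nat -(mxrank_opp Q).
    exact: (weyl_counting t b_sv a_sv E2 w0 hN').
have h2 : `|\sum_(k < n * n) q.[tau (frequency k)] - \sum_k G (a k)| <=
  (e / 4 + e / 4) * (n * n)%:R.
  rewrite -sumrB; apply: le_trans (ler_norm_sum _ _ _) _.
  rewrite mulr_natr -[X in _ *+ X]card_ord -sumr_const; apply: ler_sum => k _.
  set x := tau _; have x8 : 0 <= x <= 8 by exact: tau_bound.
  have -> : q.[x] - G (a k) = - (G (half_power x) - q.[x]) +
    (G (half_power x) - G (a k)) by ring.
  apply: le_trans (ler_normD _ _) _; rewrite normrN lerD ?hq//.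
  apply/ltW/hd2.
    rewrite powR_ge0 /= /half_power /B; have /andP[x0 x8'] := x8.
    by apply: ge0_ler_powR; rewrite ?nnegrE ?ger0_norm// ltW.
  apply: le_lt_trans eta_d2; rewrite aE -/x.
  apply: le_trans (hp _ x8).
  have pw0 : half_power x = `|half_power x| by rewrite ger0_norm// powR_ge0.
  by rewrite {1}pw0 ler_dist_dist.
have h3 : (n * n)%:R^-1 * \sum_(k < n * n) q.[tau (frequency k)] =
  torus_mean (fun t => q.[tau t]).
  have := grid_mean_fourier_sum nq.
  have -> : grid_mean n (fourier_sum Lq) =
    ((n * n)%:R^-1 * \sum_(k < n * n) q.[tau (frequency k)])%:C.
    transitivity (((n * n)%:R^-1)%:C *
      (\sum_(k < n * n) q.[tau (frequency k)])%:C).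
      rewrite natVC rmorph_sum /grid_mean; congr (_ * _).
      by apply: eq_bigr => k _; rewrite /= qL.
    exact/esym/(rmorphM (real_complex R)).
  move=> /(congr1 (@complex.Re R)) /= ->.
  by congr torus_mean; apply/funext => t; rewrite -qL.
have h4 : `|torus_mean (fun t => G (half_power (tau t))) - torus_mean (fun t =>
  q.[tau t])| <= e / 4.
  apply: torus_mean_close.
  - exact: (bborel_comp_tau cH).
  - exact: bborel_poly_tau.
  - by move=> t _; apply: hq; exact: tau_bound.
rewrite -h3 in h4.
have -> : torus_mean (fun t => G (half_power (tau t))) - (n * n)%:R^-1 * \sum_i
  G (b i) =
  (torus_mean (fun t => G (half_power (tau t))) - (n * n)%:R^-1 *
    \sum_(k < n * n) q.[tau (frequency k)]) +
  (n * n)%:R^-1 * ((\sum_(k < n * n) q.[tau (frequency k)] - \sum_k G (a k)) +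
     (\sum_k G (a k) - \sum_k G (b k))) by ring.
apply: le_trans (ler_normD _ _) _.
have -> : e = e / 4 + (n * n)%:R^-1 * ((e / 4 + e / 4) * (n * n)%:R +
  e / 4 * (n * n)%:R).
  by field; rewrite pnatr_eq0 -lt0n.
rewrite lerD// normrM gtr0_norm ?invr_gt0// ler_pM2l ?invr_gt0//.
by apply: le_trans (ler_normD _ _) _; rewrite lerD.
Qed.

Lemma continuous_Re (F : R -> R[i]^o) : continuous F ->
  continuous (fun x => complex.Re (F x) : R).
Proof.
move=> cF x; apply/cvgrPdist_lt => e e0.
have e0' : 0 < e%:C :> C by rewrite ltcR.
have /cvgrPdist_lt /(_ _ e0') := cF x.
apply: filterS => y; rewrite normcC ltcR => h.
by rewrite -cReB (le_lt_trans (normc_ge_absRe _)).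
Qed.

Lemma continuous_Im (F : R -> R[i]^o) : continuous F ->
  continuous (fun x => complex.Im (F x) : R).
Proof.
move=> cF x; apply/cvgrPdist_lt => e e0.
have e0' : 0 < e%:C :> C by rewrite ltcR.
have /cvgrPdist_lt /(_ _ e0') := cF x.
apply: filterS => y; rewrite normcC ltcR => h.
by rewrite -cImB (le_lt_trans (normc_ge_absIm _)).
Qed.

Lemma fde_sigma : sigma_distributed leb2 fde_matrix torus (t_ alpha).
Proof.
have cH : cborel (t_ alpha : T2 -> C).
  have := cborel_real (bborel_comp_tau continuous_half_power).
  by under eq_fun do rewrite -t_half_power.
split.
- exact: measurable_torus.
- suff : (0 < leb2 (torus : set T2) < +oo)%E by [].
  by rewrite leb2_torus ltry andbT lte_fin exprn_gt0// mulr_gt0// pi_gt0.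
- by have [[h1 _] [h2 _]] := cH; split; exact: measurable_funTS.
move=> F cF kF.
have [L hL] : exists L : R, forall x, L <= x -> F x = 0.
  have [M [_ hM]] := compact_bounded kF.
  exists (`|M| + 2) => x Mx; apply: contrapT => /eqP Fx.
  have M1 : M < `|M| + 1 by rewrite (le_lt_trans (ler_norm M))// ltrDl.
  have clx : closure [set y | F y != 0] x
    by exact: (@subset_closure _ [set y | F y != 0]).
  have h : `|x| <= `|M| + 1 by exact: (hM _ M1 x clx).
  by have := le_trans (ler_norm x) h; lra.
have E : ((fine (leb2 (torus : set T2)))^-1)%:C *
    cintegral leb2 torus (fun x => F (normc (t_ alpha x))) =
    torus_mean (fun t => complex.Re (F (half_power (tau t)))) +i* torus_mean
      (fun t => complex.Im (F (half_power (tau t)))).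
  rewrite (_ : fine _ = (2 * pi) ^+ 2); last exact: (congr1 fine leb2_torus).
  have pE t : normc (t_ alpha t) = half_power (tau t)
    by rewrite t_half_power normc_real ger0_norm// powR_ge0.
  have -> : (fun x => F (normc (t_ alpha x))) =
    (fun x => F (half_power (tau x))).
    by apply/funext => t; rewrite pE.
  by apply: complex_ext; rewrite ?cReM ?cImM /= mul0r ?subr0 ?addr0.
rewrite E; apply/cvgrPdist_le => eps eps0.
have [e e0 eE] : exists2 e : R, 0 < e & eps = e%:C.
  have /complex_realP[k kE] := gtr0_real eps0.
  by exists k; rewrite // -ltcR -kE.
have e2 : 0 < e / 2 by rewrite divr_gt0.
have [n1 h1] := fde_mean_singular_values (continuous_Re cF) (fun x h =>
  congr1 (@complex.Re R) (hL x h)) e2.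
have [n2 h2] := fde_mean_singular_values (continuous_Im cF) (fun x h =>
  congr1 (@complex.Im R) (hL x h)) e2.
exists (maxn n1 n2) => // n /=; rewrite geq_max => /andP[n1n n2n].
have Res (f : 'I_(n * n) -> C) : complex.Re (\sum_i f i) =
  \sum_i complex.Re (f i).
  exact: (raddf_sum (@complex.Re R : Rcomplex R -> R)).
have Ims (f : 'I_(n * n) -> C) : complex.Im (\sum_i f i) =
  \sum_i complex.Im (f i).
  exact: (raddf_sum (@complex.Im R : Rcomplex R -> R)).
pose F' : R -> C := F.
have zE : ((n * n)%:R^-1)%:C * \sum_(i < n * n) F' (sing_val (fde_matrix n) i) =
    ((n * n)%:R^-1 * \sum_(i < n * n) complex.Re
      (F (sing_val (fde_matrix n) i))) +i*
    ((n * n)%:R^-1 * \sum_(i < n * n) complex.Im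
      (F (sing_val (fde_matrix n) i))).
  by apply: complex_ext; rewrite ?cReM ?cImM ?Res ?Ims /= mul0r ?subr0 ?addr0.
rewrite natVC in zE.
rewrite eE; have -> :
  (((n * n)%:R^-1 * \sum_(i < n * n) F (sing_val (fde_matrix n) i) : C^o) =
  _) := zE.
rewrite normcC lecR; apply: le_trans (normc_leReIm _) _.
by rewrite cReB cImB /= [e]splitr lerD ?h1 ?h2.
Qed.

End Discretization.

Theorem theorem5 (R : realType) (alpha : R) (mu : R * R -> R[i])
    (halpha : 1 < alpha < 2)
    (hunbounded : forall M : R, exists2 x, square x & M < normc (mu x))
    (hriemann : forall M : R, 0 < M ->
      riemann_integrable_square (trunc_fun M mu))
    (hpointwise : forall x, square x ->
      (trunc_fun M mu x : R[i]^o) @[M --> +oo] --> (mu x : R[i]^o)) :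
  let A : mxseq := fun n =>
    toeplitz n (t_ alpha) + (hstep n `^ alpha)%:C *: diag_h n mu in
  GLT A (fun z => t_ alpha z.2) /\
  sigma_distributed leb2 A torus (t_ alpha).
Proof.
by split; [exact: fde_GLT|exact: fde_sigma].
Qed.
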